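(* Let $(M,g)$ be a closed Riemannian spin manifold of even dimension $n$ with spinor bundle $\Sigma M=\Sigma^+M\oplus\Sigma^-M$. For any differential operator $P\in\mathrm{Diff}(M,\Sigma M)$ with Agmon angle $\theta$ which is even for the $\mathbb Z_2$-grading $\Sigma M=\Sigma^+M\oplus\Sigma^-M$, one has, in a normal geodesic neighborhood $U_p$ of a point $p\in M$, $$\widetilde\omega^{\rm Res}_{\log_\theta(c^g(P))}(x)=j_g(x)\,(-2i)^{-n/2}\,\omega^{\rm sRes}_{\log_\theta(P)}(x),$$ where $j_g(x)=\sqrt{\det(g_{ij}(x))}$.
   Context: **Coordinates.** $U_p=\exp_p(B_r)$ carries normal geodesic coordinates $x=(x^1,\dots,x^n)\leftrightarrow\exp_p(\sum_ix^ie_i(p))$ for an oriented orthonormal basis $(e_i(p))$ of $T_pM$; $g_{ij}=g(\partial_{x^i},\partial_{x^j})$. Let $e_1,\dots,e_n$ be the orthonormal frame on $U_p$ obtained by Levi-Civita parallel transport of $(e_i(p))$ along geodesics from $p$, with dual coframe $e^1,\dots,e^n$. **Operators.** Clifford multiplication satisfies $v\cdot_gv\,\cdot_g=-|v|^2$; $\mathrm{C}\ell(TM)\otimes\mathbb C\simeq\mathrm{End}(\Sigma M)$; $\Sigma^\pm M$ are the $\pm1$-eigenbundles of $i^{n/2}e^1\cdot_g\cdots\cdot_ge^n\cdot_g$. $\Sigma M$ is trivialised over $U_p$ by parallel transport (spin connection) along geodesics from $p$; in it the operators $e^i\cdot_g$ are constant. $D^\gamma$ is the coordinate partial derivative with multi-index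 $\gamma$ acting componentwise. Write $P=\sum_{|\gamma|\le m}\sum_I(P_\gamma)_Ie^I\cdot_gD^\gamma$, $e^I=e^{i_1}\cdot_g\cdots\cdot_ge^{i_k}$, $i_1<\dots<i_k$. $P$ is even if it maps sections of $\Sigma^\pm M$ to sections of $\Sigma^\pm M$. $c^g:\mathrm{C}\ell(T_xM)\to\mathrm{End}(\Lambda T_x^*M)$ is the algebra morphism with $c^g(v)=v\wedge\cdot-v^{\sharp_g}\lrcorner\,\cdot$ for covectors $v$, and $c^g(P):=\sum_{\gamma,I}(P_\gamma)_Ic^g(e^I)D^\gamma$ acts on sections of $\Lambda T^*M\otimes\mathbb C$ over $U_p$, trivialised by the parallel frame $e^{i_1}\wedge\dots\wedge e^{i_k}$, with $D^\gamma$ acting componentwise. **Agmon angle and logarithm.** $P$ of order $m>0$ has Agmon angle $\theta$ if its leading symbol $\sigma_m(P)(x,\xi)$, $\xi\ne0$, has no eigenvalue on $L_\theta=\{re^{i\theta}:r\ge0\}$ and there is $\varepsilon>0$ such that $P$ has no eigenvalue in $\{re^{i\alpha}:r\ge0,|\alpha-\theta|\le\varepsilon\}$. For an operator $Q$ of order $m$ on $U_p$ whose leading symbol has no eigenvalue on $L_\theta$ for $\xi\neq 0$, the homogeneous symbol components of $\log_\theta Q$ are determined by the local symbol of $Q$: with $r_{-m}=(\sigma_m(Q)-\mu)^{-1}$ and $r_{-m-j}=-r_{-m}\sum_{a+b+|\alpha|=j,\,b<j}\frac{(-i)^{|\alpha|}}{\alpha!}\partial_\xi^\alpha\sigma_{m-a}(Q)\,\partial_x^\alpha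 r_{-m-b}$, one puts, for $\mathrm{Re}\,z<0$, $\sigma_{mz-j}(Q_\theta^z)=\frac{i}{2\pi}\int_{\Gamma_\theta}\mu_\theta^z\,r_{-m-j}\,d\mu$, where $\Gamma_\theta$ comes in from infinity along $L_\theta$ (argument $\theta$), goes clockwise around a small circle about $0$ and returns to infinity along the same ray (argument $\theta-2\pi$); this extends holomorphically to $z=0$, and $\sigma_{-j}(\log_\theta Q)(x,\xi)=|\xi|^{-j}\partial_z\big(\sigma_{mz-j}(Q_\theta^z)(x,\xi/|\xi|)\big)|_{z=0}$. **Densities.** With $|\xi|$ the Euclidean norm in the coordinates and $d_S\xi$ the standard volume form on the unit sphere, $\omega^{\rm sRes}_{\log_\theta(P)}(x)=\frac1{(2\pi)^n}\Big(\int_{|\xi|=1}\mathrm{str}\big(\sigma_{-n}(\log_\theta P)(x,\xi)\big)d_S\xi\Big)dx^1\wedge\dots\wedge dx^n$, $\mathrm{str}=\mathrm{tr}^{\Sigma^+}-\mathrm{tr}^{\Sigma^-}$; and for $Q$ acting on forms $\widetilde\omega^{\rm Res}_{\log_\theta(Q)}(x)=\frac1{(2\pi)^n}\int_{|\xi|=1}\big[\sigma_{-n}(\log_\theta Q)(x,\xi)\mathbf 1_x\big]_{[n]}d_S\xi$, where $\mathbf 1_x\in\Lambda^0T_x^*M$ is the constant $1$ and $[\cdot]_{[n]}$ the degree-$n$ part. *)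

(* Defs.v *)
From HB Require Import structures.
From mathcomp Require Import all_boot all_order all_algebra.
From mathcomp Require Import complex.
From mathcomp Require Import all_classical all_reals all_analysis.

Set Implicit Arguments.
Unset Strict Implicit.
Unset Printing Implicit Defensive.

Import Order.TTheory GRing.Theory Num.Theory.
Import numFieldNormedType.Exports.

Local Open Scope classical_set_scope.
Local Open Scope ring_scope.

Section Calculus.
Variables (R : realType) (n : nat).
Notation C := R[i].
Implicit Types (U : set 'rV[R]_n) (x v : 'rV[R]_n).

Definition enorm v : R := Num.sqrt (\sum_i v 0 i ^+ 2).

Definition eball (r : R) : set 'rV[R]_n := [set x | enorm x < r].

Definition pderiv (i : 'I_n) (f : 'rV[R]_n -> R) x : R :=
  'D_(delta_mx 0 i) f x.

Definition smooth_on U (f : 'rV[R]_n -> R) : Prop :=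
  forall (s : seq 'I_n) x, U x ->
    {for x, continuous (foldr pderiv f s)} /\
    (forall i, derivable (foldr pderiv f s) x (delta_mx 0 i)).

Definition smooth_mx U p q (f : 'rV[R]_n -> 'M[R]_(p, q)) : Prop :=
  forall i j, smooth_on U (fun x => f x i j).

Definition smoothC_on U (f : 'rV[R]_n -> C) : Prop :=
  smooth_on U (fun x => complex.Re (f x)) /\
  smooth_on U (fun x => complex.Im (f x)).

Definition smoothC_mx U p q (f : 'rV[R]_n -> 'M[C]_(p, q)) : Prop :=
  forall i j, smoothC_on U (fun x => f x i j).

Definition pderivC (i : 'I_n) (f : 'rV[R]_n -> C) x : C :=
  (pderiv i (fun y => complex.Re (f y)) x
     +i* pderiv i (fun y => complex.Im (f y)) x)%C.

(* Multi-indices with entries at most m; those of length |gamma| <= m are    *)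
(* exactly the multi-indices occurring in an operator of order m.            *)
Definition multi (m : nat) := {ffun 'I_n -> 'I_m.+1}.

Definition mlen m (gamma : multi m) : nat := (\sum_i gamma i)%N.

Definition mfact m (gamma : multi m) : nat := (\prod_i (gamma i)`!)%N.

Definition Dmulti m (gamma : multi m) (f : 'rV[R]_n -> C) : 'rV[R]_n -> C :=
  foldr (fun i h => iter (gamma i) (pderivC i) h) f (enum 'I_n).

Definition Dmulti_mx m (gamma : multi m) p q (f : 'rV[R]_n -> 'M[C]_(p, q)) x :
    'M[C]_(p, q) :=
  \matrix_(i, j) Dmulti gamma (fun y => f y i j) x.

End Calculus.

(* Integration over the unit sphere S^k of R^(k+1) for the standard volume   *)
(* form: in polar coordinates xi = (cos t, (sin t) w), 0 <= t <= pi, w in    *)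
(* S^k, the volume form of S^(k+1) is (sin t)^k dt dw.                       *)
Fixpoint sphere_int_rec (R : realType) (k : nat) :
    ('rV[R]_k.+1 -> R) -> R :=
  match k return ('rV[R]_k.+1 -> R) -> R with
  | 0 => fun f => f (const_mx 1) + f (const_mx (-1))
  | k'.+1 => fun f =>
      \int[lebesgue_measure]_(t in `[0, pi])
        (sin t ^+ k' *
         sphere_int_rec
           (fun w : 'rV[R]_k'.+1 =>
              f (row_mx (cos t)%:M (sin t *: w) : 'rV[R]_(1 + k'.+1))))
  end.

Definition sphere_int (R : realType) (n : nat) : ('rV[R]_n -> R) -> R :=
  match n return ('rV[R]_n -> R) -> R with
  | 0 => fun _ => 0
  | k.+1 => @sphere_int_rec R k
  end.

Definition sphere_intC (R : realType) (n : nat) (f : 'rV[R]_n -> R[i]) : R[i] :=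
  (sphere_int (fun xi => complex.Re (f xi))
     +i* sphere_int (fun xi => complex.Im (f xi)))%C.

Section Clifford.
Variables (R : realType) (n : nat).
Notation C := R[i].

Definition clifford_relations N (gam : 'I_n -> 'M[C]_N) : Prop :=
  forall i j, gam i *m gam j + gam j *m gam i = (- (i == j)%:R *+ 2)%:M.

Definition cliff_vec N (gam : 'I_n -> 'M[C]_N) (v : 'rV[R]_n) : 'M[C]_N :=
  \sum_i (v 0 i)%:C%C *: gam i.

(* The order of the factors matters: [enum I] is increasing.                 *)
Definition cliff_mono N (gam : 'I_n -> 'M[C]_N) (I : {set 'I_n}) : 'M[C]_N :=
  \big[mulmx/1%:M]_(i <- enum I) gam i.

Definition spin_group N (gam : 'I_n -> 'M[C]_N) : set 'M[C]_N :=
  [set s | exists vs : seq 'rV[R]_n,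
     [/\ ~~ odd (size vs), (forall v, v \in vs -> enorm v = 1)
       & s = \big[mulmx/1%:M]_(v <- vs) cliff_vec gam v]].

Definition chirality N (gam : 'I_n -> 'M[C]_N) : 'M[C]_N :=
  ('i%C : C) ^+ n./2 *: cliff_mono gam finset.setT.

(* Trace over the +1 eigenspace minus trace over the -1 eigenspace of the    *)
(* chirality operator, through the projections onto these eigenspaces.       *)
Definition proj_pm N (gam : 'I_n -> 'M[C]_N) (b : bool) : 'M[C]_N :=
  2^-1 *: (1%:M + (-1) ^+ b *: chirality gam).

Definition str N (gam : 'I_n -> 'M[C]_N) (A : 'M[C]_N) : C :=
  \tr (proj_pm gam false *m A *m proj_pm gam false)
  - \tr (proj_pm gam true *m A *m proj_pm gam true).

(* Exterior algebra of the cotangent space, in the basis                     *)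
(* e^J = e^j1 /\ .. /\ e^jk, j1 < .. < jk, of an orthonormal coframe: the     *)
(* coordinates are indexed by the subsets J through [enum_rank].             *)
Definition dimLambda : nat := #|{: {set 'I_n}}|.

Definition formrank (J : {set 'I_n}) : 'I_dimLambda := enum_rank J.

Definition koszul_sign (i : 'I_n) (J : {set 'I_n}) : C :=
  (-1) ^+ #|[pred j in J | (j < i)%N]|.

Definition wedge_mx (i : 'I_n) : 'M[C]_dimLambda :=
  \matrix_(k, l) let K : {set 'I_n} := enum_val k in
                 let J : {set 'I_n} := enum_val l in
    if (i \notin J) && (K == i |: J) then koszul_sign i J else 0.

Definition contract_mx (i : 'I_n) : 'M[C]_dimLambda :=
  \matrix_(k, l) let K : {set 'I_n} := enum_val k in
                 let J : {set 'I_n} := enum_val l in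
    if (i \in J) && (K == J :\ i) then koszul_sign i J else 0.

Definition cform (i : 'I_n) : 'M[C]_dimLambda := wedge_mx i - contract_mx i.

Definition form1 : 'cV[C]_dimLambda := delta_mx (formrank finset.set0) 0.

(* coefficient on e^1 /\ .. /\ e^n of the degree n part                      *)
Definition top_coef (w : 'cV[C]_dimLambda) : C := w (formrank finset.setT) 0.

End Clifford.

Section LogSymbol.
Variables (R : realType) (n N m : nat).
Notation C := R[i].

(* [Q gamma x] is the matrix coefficient of D^gamma = d^|gamma|/dx^gamma     *)
(* (no factor -i), so that the symbol of Q is sum_gamma Q_gamma (i xi)^gamma *)
Definition local_op := multi n m -> 'rV[R]_n -> 'M[C]_N.

Variable Q : local_op.

Definition apply_op (f : 'rV[R]_n -> 'cV[C]_N) (x : 'rV[R]_n) : 'cV[C]_N :=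
  \sum_(gamma : multi n m | (mlen gamma <= m)%N)
     Q gamma x *m Dmulti_mx gamma f x.

(* sigma_(m - a); it vanishes for a > m                                      *)
Definition hsymb (a : nat) (x xi : 'rV[R]_n) : 'M[C]_N :=
  \sum_(gamma : multi n m | (mlen gamma + a == m)%N)
     (\prod_i ('i%C * (xi 0 i)%:C%C : C) ^+ gamma i) *: Q gamma x.

Definition resolvent_symb := 'rV[R]_n -> 'rV[R]_n -> C -> 'M[C]_N.

Definition resolvent0 : resolvent_symb :=
  fun x xi mu => invmx (hsymb 0 x xi - mu%:M).

(* [rs] lists r_(-m), .., r_(-m-j+1)                                         *)
Definition resolvent_next (j : nat) (rs : seq resolvent_symb) :
    resolvent_symb := fun x xi mu =>
  - (resolvent0 x xi mu *m
     \sum_(b < j) \sum_(alpha : multi n j | (b + mlen alpha <= j)%N)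
        (((- 'i%C : C) ^+ mlen alpha / (mfact alpha)%:R) *:
         (Dmulti_mx alpha (fun eta => hsymb (j - b - mlen alpha) x eta) xi *m
          Dmulti_mx alpha
            (fun y => nth (fun _ _ _ => 0) rs b y xi mu) x))).

Fixpoint resolvents (j : nat) : seq resolvent_symb :=
  match j with
  | 0 => [::]
  | j'.+1 => rcons (resolvents j')
               (if j' == 0%N then resolvent0
                else resolvent_next j' (resolvents j'))
  end.

Definition resolvent (j : nat) : resolvent_symb :=
  nth (fun _ _ _ => 0) (resolvents j.+1) j.

Definition cexp (z : C) : C :=
  (expR (complex.Re z))%:C%C
  * (cos (complex.Im z) +i* sin (complex.Im z))%C.

(* the point of modulus s and argument phi, and its power z for this choice  *)
(* of the argument                                                           *)
Definition polar (s phi : R) : C := s%:C%C * cexp (0 +i* phi)%C.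

Definition polar_pow (z : C) (s phi : R) : C := cexp (z * (ln s +i* phi)%C).

Definition mx_integrable (D : set R) (f : R -> 'M[C]_N) : Prop :=
  forall i j,
    (@lebesgue_measure R).-integrable D
      (fun t => (complex.Re (f t i j))%:E) /\
    (@lebesgue_measure R).-integrable D
      (fun t => (complex.Im (f t i j))%:E).

Definition mx_int (D : set R) (f : R -> 'M[C]_N) : 'M[C]_N :=
  \matrix_(i, j)
    ((\int[lebesgue_measure]_(t in D) complex.Re (f t i j))
       +i* (\int[lebesgue_measure]_(t in D) complex.Im (f t i j)))%C.

(* [I] is the integral of mu_theta^z f(mu) dmu over Gamma_theta, for every   *)
(* small enough radius rho of the circle around 0: the incoming ray has      *)
(* argument theta, the circle is run clockwise from theta to theta - 2 pi,   *)
(* the outgoing ray has argument theta - 2 pi.                               *)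
Definition is_contour_int (theta : R) (z : C) (f : C -> 'M[C]_N)
    (I : 'M[C]_N) : Prop :=
  let ray phi := fun s : R =>
    (cexp (0 +i* phi)%C * polar_pow z s phi) *: f (polar s phi) in
  let circ rho := fun phi : R =>
    ('i%C * polar rho phi * polar_pow z rho phi) *: f (polar rho phi) in
  let theta' := theta - pi *+ 2 in
  \forall rho \near 0^'+,
    [/\ mx_integrable `[rho, +oo[ (ray theta),
        mx_integrable `[theta', theta] (circ rho),
        mx_integrable `[rho, +oo[ (ray theta')
      & I = - mx_int `[rho, +oo[ (ray theta)
            - mx_int `[theta', theta] (circ rho)
            + mx_int `[rho, +oo[ (ray theta')].

(* [F z] is sigma_(mz-j)(Q_theta^z)(x, xi): given by the contour integral    *)
(* for Re z < 0, and continued holomorphically to z = 0. Complex             *)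
(* differentiability is [derivable] over the field C.                        *)
Definition is_power_symb (theta : R) (j : nat) (x xi : 'rV[R]_n)
    (F : C^o -> 'M[C]_N) : Prop :=
  [/\ forall z : C^o, complex.Re z < 0 -> derivable F z 1,
      \forall z \near (0 : C^o), derivable F z 1
    & forall z : C^o, complex.Re z < 0 ->
        exists2 I, is_contour_int theta z (resolvent j x xi) I
                 & F z = ('i%C / (pi *+ 2)%:C%C : C) *: I].

(* d/dz at 0 does not depend on the chosen [F], as 0 is a limit of points    *)
(* where Re z < 0.                                                           *)
Definition log_symb (theta : R) (j : nat) (x xi : 'rV[R]_n) : 'M[C]_N :=
  ((enorm xi ^- j)%:C%C : C) *:
  xget 0 [set L | exists2 F, is_power_symb theta j x ((enorm xi)^-1 *: xi) F
                           & L = 'D_1 F (0 : C^o)].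

End LogSymbol.

(* A closed manifold with an oriented smooth atlas. The index type of the    *)
(* atlas is arbitrary, so the atlas may be enlarged by any compatible chart. *)
Record closed_manifold (R : realType) (n : nat) := ClosedManifold {
  cm_pt :> topologicalType;
  cm_compact : compact [set: cm_pt];
  cm_hausdorff : hausdorff_space cm_pt;
  cm_idx : Type;
  cm_dom : cm_idx -> set cm_pt;
  cm_coord : cm_idx -> cm_pt -> 'rV[R]_n;
  cm_param : cm_idx -> 'rV[R]_n -> cm_pt;
  cm_img := fun a => cm_coord a @` cm_dom a;
  cm_overlap := fun a b => cm_coord a @` (cm_dom a `&` cm_dom b);
  cm_trans := fun a b => cm_coord b \o cm_param a;
  cm_cover : forall p, exists a, cm_dom a p;
  cm_dom_open : forall a, open (cm_dom a);
  cm_img_open : forall a, open (cm_img a);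
  cm_coordK : forall a p, cm_dom a p -> cm_param a (cm_coord a p) = p;
  cm_coord_cont : forall a p, cm_dom a p -> {for p, continuous (cm_coord a)};
  cm_param_cont : forall a x, cm_img a x -> {for x, continuous (cm_param a)};
  cm_trans_smooth : forall a b, smooth_mx (cm_overlap a b) (cm_trans a b);
  cm_oriented : forall a b x, cm_overlap a b x ->
    0 < \det ('J (cm_trans a b) x)
}.

Arguments cm_img {R n} c a.
Arguments cm_overlap {R n} c a b.
Arguments cm_trans {R n} c a b.

Record riemannian_metric (R : realType) (n : nat)
    (M : closed_manifold R n) := RiemannianMetric {
  rm_g :> cm_idx M -> 'rV[R]_n -> 'M[R]_n;
  rm_smooth : forall a, smooth_mx (cm_img M a) (rm_g a);
  rm_sym : forall a x, cm_img M a x -> (rm_g a x)^T = rm_g a x;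
  rm_pos : forall a x (v : 'rV[R]_n), cm_img M a x -> v != 0 ->
    0 < (v *m rm_g a x *m v^T) 0 0;
  (* 'J f x acts on row vectors: its (i, j) entry is the derivative of f_j   *)
  (* along the i-th coordinate                                               *)
  rm_change : forall a b x, cm_overlap M a b x ->
    rm_g a x = 'J (cm_trans M a b) x *m rm_g b (cm_trans M a b x)
                 *m ('J (cm_trans M a b) x)^T
}.

(* A spin structure and its spinor bundle, given on each chart by an         *)
(* oriented orthonormal frame [ss_frame] (row i holds the coordinates of     *)
(* e_i) and on overlaps by a Spin(n)-valued cocycle lifting the change of    *)
(* frames. The spinor module has dimension 2^(n/2); [ss_gam i] is the        *)
(* Clifford multiplication by e_i, in the trivialisation of the spinor       *)
(* bundle induced by the frame.                                              *)
Record spin_structure (R : realType) (n : nat) (M : closed_manifold R n)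
    (g : riemannian_metric M) := SpinStructure {
  ss_gam : 'I_n -> 'M[R[i]]_(2 ^ n./2);
  ss_clifford : clifford_relations ss_gam;
  ss_frame : cm_idx M -> 'rV[R]_n -> 'M[R]_n;
  ss_frame_smooth : forall a, smooth_mx (cm_img M a) (ss_frame a);
  ss_frame_orth : forall a x, cm_img M a x ->
    ss_frame a x *m g a x *m (ss_frame a x)^T = 1%:M;
  ss_frame_oriented : forall a x, cm_img M a x -> 0 < \det (ss_frame a x);
  (* e_i (frame a) = sum_j (ss_change a b x)_ij e_j (frame b)                *)
  ss_change := fun a b x =>
    ss_frame a x *m 'J (cm_trans M a b) x
      *m invmx (ss_frame b (cm_trans M a b x));
  ss_lift : cm_idx M -> cm_idx M -> 'rV[R]_n -> 'M[R[i]]_(2 ^ n./2);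
  ss_lift_smooth : forall a b, smoothC_mx (cm_overlap M a b) (ss_lift a b);
  ss_lift_spin : forall a b x, cm_overlap M a b x ->
    spin_group ss_gam (ss_lift a b x);
  ss_lift_change : forall a b x i, cm_overlap M a b x ->
    ss_lift a b x *m ss_gam i =
    cliff_vec ss_gam (row i (ss_change a b x)) *m ss_lift a b x;
  ss_cocycle : forall a b c p,
    cm_dom a p -> cm_dom b p -> cm_dom c p ->
    ss_lift a c (cm_coord a p) =
    ss_lift b c (cm_coord b p) *m ss_lift a b (cm_coord a p)
}.

Section SpinManifold.
Variables (R : realType) (n : nat) (M : closed_manifold R n).
Variables (g : riemannian_metric M) (S : spin_structure g).
Notation C := R[i].
Notation N := (2 ^ n./2)%N.

(* Sections of the spinor bundle, by their components in each chart (only    *)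
(* the values on the image of the chart are meaningful)                      *)
Definition spinor_field := cm_idx M -> 'rV[R]_n -> 'cV[C]_N.

Definition is_section (psi : spinor_field) : Prop :=
  (forall a, smoothC_mx (cm_img M a) (psi a)) /\
  (forall a b x, cm_overlap M a b x ->
     psi b (cm_trans M a b x) = ss_lift S a b x *m psi a x).

Definition spinor_eq (psi phi : spinor_field) : Prop :=
  forall a x, cm_img M a x -> psi a x = phi a x.

Definition has_chirality (b : bool) (psi : spinor_field) : Prop :=
  spinor_eq (fun a x => chirality (ss_gam S) *m psi a x)
            (fun a x => (-1) ^+ b *: psi a x).

(* sum_I (P_gamma)_I c(e^I), where c(e^i) = c i                              *)
Definition clifford_op k m (c : 'I_n -> 'M[C]_k)
    (P : multi n m -> {set 'I_n} -> 'rV[R]_n -> C) : local_op R n k m :=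
  fun gamma x => \sum_(I : {set 'I_n}) P gamma I x *: cliff_mono c I.

(* A differential operator on spinors is given in each chart by the          *)
(* coefficients (P_gamma)_I of P = sum (P_gamma)_I e^I D^gamma; since        *)
(* Cl(TM) (x) C = End(Sigma M), every endomorphism coefficient is of this    *)
(* form. The local expressions must agree on overlaps.                       *)
Record diff_op (m : nat) := DiffOp {
  do_coef : cm_idx M -> multi n m -> {set 'I_n} -> 'rV[R]_n -> C;
  do_smooth : forall a gamma I, smoothC_on (cm_img M a) (do_coef a gamma I);
  do_local := fun a => clifford_op (ss_gam S) (do_coef a);
  do_apply := (fun psi a => apply_op (do_local a) (psi a))
                : spinor_field -> spinor_field;
  do_section : forall psi, is_section psi -> is_section (do_apply psi)
}.

Definition even_op m (P : diff_op m) : Prop :=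
  forall b psi, is_section psi -> has_chirality b psi ->
    has_chirality b (do_apply P psi).

Definition op_eigenvalue m (P : diff_op m) (lambda : C) : Prop :=
  exists psi : spinor_field,
    [/\ is_section psi, ~ spinor_eq psi (fun _ _ => 0)
      & spinor_eq (do_apply P psi) (fun a x => lambda *: psi a x)].

Definition agmon_angle m (P : diff_op m) (theta : R) : Prop :=
  (forall a x (xi : 'rV[R]_n) (s : R), cm_img M a x -> xi != 0 -> 0 <= s ->
     ~~ eigenvalue (hsymb (do_local P a) 0 x xi) (polar s theta)) /\
  (exists2 eps : R, 0 < eps &
     forall s alpha : R, 0 <= s -> `|alpha - theta| <= eps ->
       ~ op_eigenvalue P (polar s alpha)).

Definition christoffel (a : cm_idx M) (k i j : 'I_n) (x : 'rV[R]_n) : R :=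
  2^-1 * \sum_l invmx (g a x) k l *
    (pderiv i (fun y => g a y j l) x + pderiv j (fun y => g a y i l) x
     - pderiv l (fun y => g a y i j) x).

(* The vector field V along the curve c, both defined near [0, 1] in the     *)
(* chart a, is parallel for the Levi-Civita connection.                      *)
Definition parallel_along (a : cm_idx M) (c V : R -> 'rV[R]_n) : Prop :=
  forall t : R, 0 <= t <= 1 ->
    [/\ derivable c t 1, derivable V t 1
      & forall k, derive1 V t 0 k
          + \sum_i \sum_j christoffel a k i j (c t) * derive1 c t 0 i * V t 0 j
        = 0].

(* The chart a is the normal geodesic neighbourhood U_p = exp_p(B_r), with   *)
(* coordinates x <-> exp_p(sum_i x^i e_i(p)), and its frame is obtained from *)
(* (e_i(p)) by parallel transport along the geodesics from p. As the spin    *)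
(* connection lifts the Levi-Civita connection, the trivialisation of the    *)
(* spinor bundle induced by this frame is the one by parallel transport for  *)
(* the spin connection along the same geodesics.                             *)
Definition normal_neighborhood (a : cm_idx M) (p : M) (r : R) : Prop :=
  [/\ 0 < r, cm_dom a p, cm_coord a p = 0, cm_img M a = eball r
    & forall x, eball r x -> exists c : R -> 'rV[R]_n,
        [/\ forall t : R, 0 <= t <= 1 -> eball r (c t),
            c 0 = 0, derive1 c 0 = x *m ss_frame S a 0, c 1 = x
          & parallel_along a c (derive1 c) /\
            forall i, parallel_along a c (fun t => row i (ss_frame S a (c t)))]].

Definition vol_density (a : cm_idx M) (x : 'rV[R]_n) : R :=
  Num.sqrt (\det (g a x)).

(* row i holds the coordinates of the covector e^i in the basis (dx^j)       *)
Definition coframe (a : cm_idx M) (x : 'rV[R]_n) : 'M[R]_n :=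
  (invmx (ss_frame S a x))^T.

(* c^g(P), forms being taken in the frame e^J of the chart a *)
Definition cg_op m (P : diff_op m) (a : cm_idx M) :
    local_op R n (dimLambda n) m :=
  clifford_op (@cform R n) (do_coef P a).

(* Both densities are given by their coefficient on dx^1 /\ .. /\ dx^n; in   *)
(* the second one, e^1 /\ .. /\ e^n = det(coframe) dx^1 /\ .. /\ dx^n.       *)
Definition omega_sres m (P : diff_op m) (theta : R) (a : cm_idx M)
    (x : 'rV[R]_n) : C :=
  ((pi *+ 2) ^- n)%:C%C *
  sphere_intC (fun xi =>
    str (ss_gam S) (log_symb (do_local P a) theta n x xi)).

Definition omega_res_form m (Q : local_op R n (dimLambda n) m) (theta : R)
    (a : cm_idx M) (x : 'rV[R]_n) : C :=
  ((pi *+ 2) ^- n)%:C%C *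
  sphere_intC (fun xi =>
    top_coef (log_symb Q theta n x xi *m form1 R n)
    * (\det (coframe a x))%:C%C).

End SpinManifold.

(* Main.v *)
Require Import Defs.
From HB Require Import structures.
From mathcomp Require Import all_boot all_order all_algebra.
From mathcomp Require Import complex.
From mathcomp Require Import all_classical all_reals all_analysis.
From mathcomp Require Import ring.
Import Order.TTheory GRing.Theory Num.Theory.
Import numFieldNormedType.Exports.
Set Implicit Arguments.
Unset Strict Implicit.
Unset Printing Implicit Defensive.
Local Open Scope ring_scope.

(* Since n is even, the 2^n monomials e^I form a basis of End(Sigma), so
   Clifford multiplication on forms extends to a unital, faithful algebra
   morphism Phi from End(Sigma) to End(Lambda) with Phi(A) 1 = sum_I A_I e^I.
   Both densities then read off the same coefficient A_{1..n}: it is the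
   degree n part of Phi(A) 1, and str(A) = i^(n/2) tr(e^1..e^n A) is
   (-2i)^(n/2) A_{1..n}. As every step from the local symbol to the logarithmic
   symbol (resolvent recursion, contour integral, continuation to z = 0) uses
   only linear operations, products and inverses, it commutes with Phi; the
   inverse image of a power symbol on forms is recovered by the linear left
   inverse of Phi. Finally det(coframe) = sqrt(det g). *)

(** * The Clifford algebra and its action on forms *)

(** Commuting with Phi is pure algebra for sums, products and inverses; the analytic steps are the
    obstacle, because derivatives, [invmx], [xget] and [fine] are total and return default values.
    Derivatives commute with Phi only where the entries are smooth, so the resolvent recursion is
    compared on an open set where the leading symbol minus mu stays invertible, not just at x.
    Contour integrals need this at every mu of the contour: the Agmon condition covers the rays and
    finiteness of the spectrum covers small circles. [log_symb] is 0 when no power symbol exists, so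
    existence has to pass through Phi in both directions. In the last step the constant must leave a
    sphere integral whose integrand is not known to be integrable; this works because (-2i)^-1 = i/2
    is purely imaginary, so that its powers act on real and imaginary parts only by real factors and
    swaps. *)

Lemma linear_mxE (K : comNzRingType) p q p' q'
    (Phi : {linear 'M[K]_(p, q) -> 'M[K]_(p', q')}) A k l : Phi A k l =
  \sum_(u : 'I_p * 'I_q) Phi (delta_mx u.1 u.2) k l * A u.1 u.2.
Proof.
rewrite {1}(matrix_sum_delta A) linear_sum summxE.
rewrite -(pair_bigA _ (fun i j => Phi (delta_mx i j) k l * A i j)) /=.
apply: eq_bigr => i _; rewrite linear_sum summxE; apply: eq_bigr => j _.
by rewrite linearZ mxE mulrC.
Qed.

(** Needed because [dimLambda n] and [N * N] are equal only propositionally. *)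
Lemma mulmx1C_eq (F : comUnitRingType) m p (A : 'M[F]_(m, p)) (B : 'M[F]_(p, m)) :
  m = p -> A *m B = 1%:M -> B *m A = 1%:M.
Proof. by move=> e; subst p; apply: mulmx1C. Qed.

(** The prefix [s] holds the factors that [gam i] must cross to reach its place in the increasing
    product; its size is the exponent of the Koszul sign. *)
Lemma enum_setU1_lt n (i : 'I_n) (J : {set 'I_n}) : i \notin J ->
  exists s t, [/\ enum J = s ++ t, enum (i |: J)%SET = s ++ i :: t,
    i \notin s & size s = #|[pred j in J | (j < i)%N]|].
Proof.
move=> iJ; pose s := enum [pred j in J | (j < i)%N].
pose t := enum [pred j in J | (i < j)%N].
have sortE (A : {pred 'I_n}) : sorted (fun a b : 'I_n => (a < b)%N) (enum A).
  have tr : transitive (fun a b : 'I_n => (a < b)%N) by move=> b a c; apply: ltn_trans.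
  apply: (subseq_sorted tr (s2 := enum 'I_n)).
    by rewrite enumT /enum_mem; apply: filter_subseq.
  change (is_true (sorted (relpre (val : 'I_n -> nat) ltn) (enum 'I_n))).
  by rewrite -sorted_map val_enum_ord iota_ltn_sorted.
(* Two strictly increasing lists with the same members coincide, so both equations reduce to
   sortedness and membership. *)
have eq_sort := @irr_sorted_eq _ (fun a b : 'I_n => (a < b)%N)
   (fun b a c => @ltn_trans b a c) (fun a => ltnn a).
have pw (A : {pred 'I_n}) : pairwise (fun a b : 'I_n => (a < b)%N) (enum A).
  by rewrite -sorted_pairwise ?sortE // => b a c; apply: ltn_trans.
exists s, t; split.
- apply: eq_sort; first exact: sortE.
    rewrite sorted_pairwise; last by move=> b a c; apply: ltn_trans.
    rewrite pairwise_cat !pw !andbT; apply/allrelP => a b.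
    by rewrite !mem_enum !inE => /andP[_ ai] /andP[_]; apply: ltn_trans.
  move=> k; rewrite mem_cat !mem_enum !inE -andb_orr -neq_ltn.
  by case kJ: (k \in J) => //=; case: eqP => // e;
     move: iJ; rewrite -(val_inj e) kJ.
- apply: eq_sort; first exact: sortE.
    rewrite sorted_pairwise; last by move=> b a c; apply: ltn_trans.
    rewrite pairwise_cat /= !pw !andbT; apply/andP; split.
      apply/allrelP => a b; rewrite inE !mem_enum !inE => /andP[_ ai].
      by case/orP => [/eqP->//|/andP[_]]; apply: ltn_trans.
    by apply/allP => b; rewrite mem_enum inE => /andP[].
  move=> k; rewrite mem_cat in_cons !mem_enum !inE -val_eqE /=.
  by case kJ: (k \in J); rewrite ?orbF //= orbT; case: ltngtP.
- by rewrite mem_enum inE ltnn andbF.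
- by rewrite cardE.
Qed.

Lemma big_mulmx_cat (F : comNzRingType) p (I : Type) (s t : seq I) (A : I -> 'M[F]_p) :
  \big[mulmx/1%:M]_(i <- s ++ t) A i =
  (\big[mulmx/1%:M]_(i <- s) A i) *m \big[mulmx/1%:M]_(i <- t) A i.
Proof.
by elim: s => [|i s IH] /=; rewrite ?big_nil ?mul1mx // !big_cons IH mulmxA.
Qed.

Section CliffordModule.
Variables (R : realType) (n N : nat) (gam : 'I_n -> 'M[R[i]]_N).
Hypothesis gamP : clifford_relations gam.

Let cprod (s : seq 'I_n) : 'M[R[i]]_N := \big[mulmx/1%:M]_(i <- s) gam i.

Lemma clifford_sq i : gam i *m gam i = - 1%:M.
Proof.
have h : (2 : R[i]) != 0 by rewrite pnatr_eq0.
apply: (scalerI h); rewrite scaler_nat mulr2n gamP eqxx.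
by rewrite scalerN scalemx1 mulNrn raddfN.
Qed.

Lemma clifford_anticomm i j : i != j -> gam i *m gam j = - (gam j *m gam i).
Proof.
move=> /negPf ij; apply/eqP; rewrite -addr_eq0 gamP ij oppr0 mul0rn.
by rewrite raddf0.
Qed.

(** Each factor other than [gam k] contributes a sign, [gam k] itself none; adding [k \in s] to the
    exponent instead of subtracting it keeps its parity. *)
Lemma cprod_comm k s : uniq s ->
  gam k *m cprod s = (-1) ^+ (size s + (k \in s)) *: (cprod s *m gam k).
Proof.
rewrite /cprod; elim: s => [_|j s IH] /=.
  by rewrite big_nil mulmx1 mul1mx scale1r.
case/andP=> js us; rewrite !big_cons inE.
have [e|kj] /= := eqVneq k j.
  subst j; rewrite [in LHS](IH us) -scalemxAr mulmxA (negPf js) addn0 addn1.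
  by rewrite !exprS mulrA mulrNN mulr1 mul1r.
rewrite [LHS]mulmxA clifford_anticomm // mulNmx -(mulmxA (gam j) (gam k)) (IH us).
by rewrite -scalemxAr mulmxA addSn exprS mulN1r scaleNr.
Qed.

Lemma cliff_mono_comm k I : gam k *m cliff_mono gam I =
  (-1) ^+ (#|I| + (k \in I)) *: (cliff_mono gam I *m gam k).
Proof. by rewrite /cliff_mono cprod_comm ?enum_uniq // -cardE mem_enum. Qed.

Lemma clifford_unit i : gam i \in unitmx.
Proof.
have : gam i *m (- gam i) = 1%:M by rewrite mulmxN clifford_sq opprK.
by case/mulmx1_unit.
Qed.

Lemma cliff_mono_unit I : cliff_mono gam I \in unitmx.
Proof.
rewrite /cliff_mono; elim/big_rec: _ => [|i A _]; first exact: unitmx1.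
by rewrite unitmx_mul clifford_unit.
Qed.

Lemma mul_cliff_mono i (J : {set 'I_n}) : i \notin J ->
  gam i *m cliff_mono gam J = koszul_sign R i J *: cliff_mono gam (i |: J)%SET.
Proof.
move=> /enum_setU1_lt[s [t [eJ eiJ nis sz]]].
rewrite /cliff_mono eJ eiJ !big_mulmx_cat big_cons [LHS]mulmxA.
have us : uniq s by move: (enum_uniq J); rewrite eJ cat_uniq => /and3P[].
have := cprod_comm i us; rewrite /cprod (negPf nis) addn0 sz => ->.
by rewrite -/(koszul_sign R i J) -scalemxAl !mulmxA.
Qed.

(** Multiply the case [i \notin J], taken at [J :\ i], by [gam i] and use that its square is -1. The
    Koszul sign only counts elements below i, so removing i leaves it unchanged. *)
Lemma mul_cliff_mono_in i (J : {set 'I_n}) : i \in J ->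
  gam i *m cliff_mono gam J = - koszul_sign R i J *: cliff_mono gam (J :\ i)%SET.
Proof.
move=> iJ; have iJ' : i \notin (J :\ i)%SET by rewrite !inE eqxx.
have e : koszul_sign R i (J :\ i)%SET = koszul_sign R i J.
  rewrite /koszul_sign; congr (_ ^+ _); apply: eq_card => k; rewrite !inE.
  by rewrite -val_eqE /=; case: ltngtP; rewrite ?andbF.
have s2 : koszul_sign R i J * koszul_sign R i J = 1.
  by rewrite /koszul_sign -expr2 sqrr_sign.
have := mul_cliff_mono iJ'; rewrite finset.setD1K // e.
move=> /(congr1 (fun A => koszul_sign R i J *: A)); rewrite scalerA s2 scale1r => <-.
by rewrite -scalemxAr mulmxA clifford_sq mulNmx mul1mx scalerN scaleNr.
Qed.

(** For k factors, reversing one copy costs 'C(k, 2) signs and the k squares cost k more, in total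
    'C(k + 1, 2). *)
Lemma cprod_sq s : uniq s ->
  cprod s *m cprod s = ((-1) ^+ 'C((size s).+1, 2))%:M.
Proof.
rewrite /cprod; elim: s => [_|j s IH] /=; first by rewrite big_nil mul1mx.
case/andP=> js us; rewrite !big_cons -mulmxA (mulmxA _ (gam j)).
have := cprod_comm j us; rewrite (negPf js) addn0 /cprod => e.
have -> : (\big[mulmx/1%:M]_(i <- s) gam i) *m gam j =
          (-1) ^+ size s *: (gam j *m \big[mulmx/1%:M]_(i <- s) gam i).
  by rewrite e scalerA -expr2 sqrr_sign scale1r.
rewrite -scalemxAl -scalemxAr !mulmxA clifford_sq mulNmx mul1mx mulNmx.
rewrite (IH us) scalerN -scaleNr scale_scalar_mx; congr (_%:M).
by rewrite -mulN1r -exprS -exprD [in RHS]binS bin1 addnC.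
Qed.

End CliffordModule.

(** By cyclicity of the trace only the squares of the projections matter, and ((1 + X)/2)^2 - ((1 -
    X)/2)^2 = X for every matrix X. *)
Lemma str_chirality (R : realType) n N (gam : 'I_n -> 'M[R[i]]_N) A :
  str gam A = \tr (chirality gam *m A).
Proof.
have e (B : 'M[R[i]]_N) : \tr (B *m A *m B) = \tr (B *m B *m A).
  by rewrite mxtrace_mulC mulmxA.
have -> : str gam A = \tr ((proj_pm gam false *m proj_pm gam false
    - proj_pm gam true *m proj_pm gam true) *m A).
  by rewrite mulmxBl raddfB /str; congr (_ - _); apply: e.
congr (\tr (_ *m _)); rewrite /proj_pm expr0 expr1 scale1r scaleN1r.
move: (chirality gam) => X.
rewrite -!scalemxAl -!scalemxAr -!scalerBr !mulmxDl !mulmxDr !mul1mx !mulmx1.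
rewrite mulNmx mulmxN opprK; move: (X *m X) (1%:M) => Y I1.
by apply/matrixP => i j; rewrite !mxE; field.
Qed.

(** * Independence of the Clifford monomials and left multiplication on them *)

Section CliffordRep.
Variables (R : realType) (n N : nat) (gam : 'I_n -> 'M[R[i]]_N).
Hypotheses (gamP : clifford_relations gam) (n_even : ~~ odd n).
Hypotheses (N_gt0 : (0 < N)%N) (dimN : dimLambda n = (N * N)%N).
Notation cm := (cliff_mono gam).

(** If e^I and e^J had the same sign with every [gam k], membership in I and J would agree for all k
    or differ for all k. The second case makes J the complement of I with |I| + |J| odd, against n
    even. For odd n it does occur: the product of all [gam k] is then central, like 1. *)
Lemma exists_sign_differs (I J : {set 'I_n}) : I != J ->
  exists k, odd (#|I| + (k \in I) + (#|J| + (k \in J))).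
Proof.
move=> IJ; apply/existsP; apply: contraNT IJ; rewrite negb_exists => /forallP h.
have {}h k : (k \in I) (+) (k \in J) = odd (#|I| + #|J|).
  have := h k; rewrite !oddD !oddb.
  by case: (odd #|I|); case: (odd #|J|); case: (k \in I); case: (k \in J).
case e : (odd (#|I| + #|J|)) in h.
  have JI : J = finset.setC I.
    apply/setP => k; have := h k; rewrite inE.
    by case: (k \in I); case: (k \in J).
  by move: e; rewrite JI cardsC card_ord (negPf n_even).
by apply/eqP/setP => k; have := h k; case: (k \in I); case: (k \in J).
Qed.

(** The product anticommutes with some invertible [gam k]; conjugating by it changes the sign and
    preserves the trace. *)
Lemma tr_cliff_mono_orth I J : I != J -> \tr (invmx (cm J) *m cm I) = 0.
Proof.
move=> /exists_sign_differs[k odd_k]; have uJ := cliff_mono_unit gamP J.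
set sI := (-1) ^+ (#|I| + (k \in I)) : R[i].
set sJ := (-1) ^+ (#|J| + (k \in J)) : R[i].
have eJ : invmx (cm J) *m gam k = sJ *: (gam k *m invmx (cm J)).
  rewrite -[LHS](mulmxK uJ) -(mulmxA _ (gam k)) (cliff_mono_comm gamP).
  by rewrite -scalemxAr mulKmx // -scalemxAl.
have sIJ : sJ * sI = -1 by rewrite -exprD addnC -signr_odd odd_k expr1.
move: (invmx (cm J)) (cliff_mono_comm gamP k I) eJ => Y eI eJ.
have eX : gam k *m (Y *m cm I) = - ((Y *m cm I) *m gam k).
  have sJ2 : sJ * sJ = 1 by rewrite -expr2 sqrr_sign.
  have -> : gam k *m (Y *m cm I) = sJ *: (Y *m gam k *m cm I).
    by rewrite eJ -scalemxAl scalerA sJ2 scale1r mulmxA.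
  by rewrite -mulmxA eI -scalemxAr scalerA sIJ scaleN1r mulmxA.
move: (Y *m cm I) eX => X eX; have uk := clifford_unit gamP k.
have : \tr X = - \tr X.
  rewrite -{1}(mulKmx uk X) eX mulmxN raddfN /=.
  by rewrite mxtrace_mulC -mulmxA mulmxV // mulmx1.
by move/eqP; rewrite -addr_eq0 -mulr2n mulrn_eq0 /= => /eqP.
Qed.

(** The coordinate of B along e^K, obtained from the trace pairing; dividing by N normalises the
    trace of the identity. *)
Definition cliff_coef (K : {set 'I_n}) (B : 'M[R[i]]_N) : R[i] :=
  N%:R^-1 * \tr (invmx (cm K) *m B).

Lemma cliff_coefD K A B : cliff_coef K (A + B) = cliff_coef K A + cliff_coef K B.
Proof. by rewrite /cliff_coef mulmxDr mxtraceD mulrDr. Qed.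

Lemma cliff_coefZ K c A : cliff_coef K (c *: A) = c * cliff_coef K A.
Proof. by rewrite /cliff_coef -scalemxAr mxtraceZ mulrCA. Qed.

Lemma cliff_coef_sum K (I : finType) (c : I -> R[i]) (A : I -> 'M[R[i]]_N) :
  cliff_coef K (\sum_i c i *: A i) = \sum_i c i * cliff_coef K (A i).
Proof.
rewrite /cliff_coef mulmx_sumr raddf_sum mulr_sumr; apply: eq_bigr => i _.
by rewrite -scalemxAr [X in _ * X = _]mxtraceZ mulrCA.
Qed.

Lemma cliff_coef_mono K L : cliff_coef K (cm L) = (K == L)%:R.
Proof.
rewrite /cliff_coef eq_sym; have [->|LK] := eqVneq L K.
  rewrite mulVmx ?cliff_mono_unit // mxtrace1 mulVf //.
  by rewrite pnatr_eq0 -lt0n.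
by rewrite tr_cliff_mono_orth // mulr0.
Qed.

(* The 2^n = N^2 monomials are linearly independent, hence they span. *)
Lemma cliff_expand B : B = \sum_K cliff_coef K B *: cm K.
Proof.
(* The rows of [G] are the flattened monomials, and right multiplication by [H] reads off the
   coordinates, so [H *m G] is the expansion map. *)
pose G : 'M[R[i]]_(dimLambda n, N * N) := \matrix_k mxvec (cm (enum_val k)).
pose H : 'M[R[i]]_(N * N, dimLambda n) :=
  \matrix_(r, k) cliff_coef (enum_val k) (vec_mx (delta_mx 0 r)).
have HE v : v *m H = \row_k cliff_coef (enum_val k) (vec_mx v).
  apply/rowP => k; rewrite !mxE {2}(row_sum_delta v) raddf_sum /=.
  rewrite (eq_bigr (fun r => v 0 r *: vec_mx (delta_mx 0 r))).
    by rewrite cliff_coef_sum; apply: eq_bigr => r _; rewrite !mxE.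
  by move=> r _; rewrite linearZ.
have GH : G *m H = 1%:M.
  apply/row_matrixP => k; rewrite row_mul rowK HE mxvecK; apply/rowP => l.
  rewrite !mxE cliff_coef_mono; congr (_%:R); congr nat_of_bool.
  by rewrite (inj_eq enum_val_inj) eq_sym.
have HG := mulmx1C_eq dimN GH.
apply: (can_inj mxvecK); rewrite -[LHS]mulmx1 -HG mulmxA HE mxvecK.
rewrite mulmx_sum_row raddf_sum /= (reindex_onto enum_rank enum_val) /=.
  apply: eq_big => [K|K _]; first by rewrite enum_rankK eqxx.
  by rewrite rowK !mxE linearZ enum_rankK.
by move=> k _; rewrite enum_valK.
Qed.

(** Left multiplication by A on End(Sigma), written in the basis of monomials, with the form e^J
    identified with [cm J] (the quantisation map). *)
Definition cliff_rep (A : 'M[R[i]]_N) : 'M[R[i]]_(dimLambda n) :=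
  \matrix_(k, l) cliff_coef (enum_val k) (A *m cm (enum_val l)).

(** Applies B to the form 1, the column of the empty set, and reads the result as a Clifford
    element. It is defined and linear on all of End(Lambda), not only on the image of [cliff_rep],
    hence applies to an arbitrary power symbol on forms. *)
Definition cliff_unrep (B : 'M[R[i]]_(dimLambda n)) : 'M[R[i]]_N :=
  \sum_(K : {set 'I_n}) B (formrank K) (formrank finset.set0) *: cm K.

Lemma cliff_rep_is_linear : linear cliff_rep.
Proof.
move=> c A B; apply/matrixP => k l.
by rewrite !mxE mulmxDl cliff_coefD -scalemxAl cliff_coefZ.
Qed.
HB.instance Definition _ := GRing.isLinear.Build R[i] 'M[R[i]]_N
  'M[R[i]]_(dimLambda n) *:%R cliff_rep cliff_rep_is_linear.

Lemma cliff_unrep_is_linear : linear cliff_unrep.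
Proof.
move=> c A B; rewrite /cliff_unrep scaler_sumr -big_split /=.
by apply: eq_bigr => K _; rewrite !mxE scalerDl scalerA.
Qed.
HB.instance Definition _ := GRing.isLinear.Build R[i] 'M[R[i]]_(dimLambda n)
  'M[R[i]]_N *:%R cliff_unrep cliff_unrep_is_linear.

Lemma cliff_repM A B : cliff_rep (A *m B) = cliff_rep A *m cliff_rep B.
Proof.
apply/matrixP => k l; rewrite !mxE -mulmxA {1}(cliff_expand (B *m _)).
rewrite mulmx_sumr (eq_bigr (fun K =>
  cliff_coef K (B *m cm (enum_val l)) *: (A *m cm K))).
  rewrite cliff_coef_sum (reindex_onto enum_val enum_rank) /=.
    apply: eq_big => [K|K _]; first by rewrite enum_valK eqxx.
    by rewrite !mxE; apply: mulrC.
  by move=> K _; rewrite enum_rankK.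
by move=> K _; rewrite scalemxAr.
Qed.

Lemma cliff_rep1 : cliff_rep 1%:M = 1%:M.
Proof.
apply/matrixP => k l; rewrite !mxE mul1mx cliff_coef_mono.
by rewrite (inj_eq enum_val_inj).
Qed.

(** On e^J only the wedge acts if i is outside J and only the contraction if i is inside; the minus
    sign of the contraction comes from [gam i] squaring to -1. *)
Lemma cliff_rep_gam i : cliff_rep (gam i) = cform R i.
Proof.
apply/matrixP => k l; rewrite !mxE.
set J := enum_val l; have [iJ|iJ] := boolP (i \in J).
  rewrite (mul_cliff_mono_in gamP iJ) cliff_coefZ cliff_coef_mono; cbv zeta.
  rewrite iJ [~~ true]/= andFb andTb sub0r.
  by case: eqP => _; rewrite ?mulr1 ?mulr0 ?oppr0.
rewrite (mul_cliff_mono gamP iJ) cliff_coefZ cliff_coef_mono; cbv zeta.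
rewrite iJ (negPf iJ) andFb andTb subr0.
by case: eqP => _; rewrite ?mulr1 ?mulr0.
Qed.

Lemma cliff_rep_mono I : cliff_rep (cm I) = cliff_mono (@cform R n) I.
Proof.
rewrite /cliff_mono; elim: (enum I) => [|i s IH].
  by rewrite !big_nil cliff_rep1.
by rewrite !big_cons cliff_repM IH cliff_rep_gam.
Qed.

Lemma cliff_repE A K : cliff_rep A (formrank K) (formrank finset.set0) = cliff_coef K A.
Proof.
rewrite mxE !enum_rankK; congr cliff_coef.
by rewrite /cliff_mono enum_set0 big_nil mulmx1.
Qed.

Lemma cliff_repK : cancel cliff_rep cliff_unrep.
Proof.
move=> A; rewrite [RHS]cliff_expand; apply: eq_bigr => K _.
by rewrite cliff_repE.
Qed.

Lemma top_coef_cliff_rep A :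
  top_coef (cliff_rep A *m form1 R n) = cliff_coef finset.setT A.
Proof. by rewrite -cliff_repE /top_coef /form1 -colE mxE. Qed.

(* Holds for singular A too: faithfulness makes cliff_rep A singular as well,
   and invmx is the identity on singular matrices. *)
Lemma cliff_rep_inv A : cliff_rep (invmx A) = invmx (cliff_rep A).
Proof.
have [uA|uA] := boolP (A \in unitmx).
  have e : cliff_rep A *m cliff_rep (invmx A) = 1%:M.
    by rewrite -cliff_repM mulmxV // cliff_rep1.
  have [u _] := mulmx1_unit e.
  by rewrite -[LHS](mulKmx u) e mulmx1.
have uA' : cliff_rep A \notin unitmx.
  apply: contra uA => u; rewrite -row_free_unit -kermx_eq0.
  have : cliff_rep (kermx A) *m cliff_rep A = 0.
    by rewrite -cliff_repM mulmx_ker linear0.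
  move=> /(congr1 (mulmx^~ (invmx (cliff_rep A)))).
  by rewrite mulmxK // mul0mx => /(congr1 cliff_unrep); rewrite cliff_repK linear0 => ->.
by rewrite /invmx (negPf uA) (negPf uA').
Qed.

(** The top monomial squares to (-1)^(n/2), so it is its own inverse up to that sign. The constant
    is then 2^(-n/2) (-1)^(n/2) = i^(n/2) (-2i)^(-n/2), since i / (-2i) = -1/2. *)
Lemma cliff_coef_setT A : N = (2 ^ n./2)%N ->
  cliff_coef finset.setT A = (- (2%:R * 'i%C)) ^- n./2 * str gam A.
Proof.
move=> eN; rewrite str_chirality /chirality -scalemxAl mxtraceZ mulrA.
have sq : cm finset.setT *m cm finset.setT = ((-1) ^+ n./2)%:M.
  have := cprod_sq gamP (enum_uniq (mem (finset.setT : {set 'I_n}))).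
  rewrite -cardE cardsT card_ord -/(cliff_mono gam finset.setT) => ->.
  (* 'C(n + 1, 2) = (n + 1)(n/2) has the parity of n/2, as n + 1 is odd. *)
  congr (_%:M); rewrite -signr_odd -[in RHS]signr_odd; congr (_ ^+ _).
  rewrite bin2 /= -{1 2}(odd_double_half n) (negPf n_even) add0n.
  by rewrite -doubleMr doubleK oddM /= odd_double.
have u := cliff_mono_unit gamP finset.setT.
have e : invmx (cm finset.setT) *m A = (-1) ^+ n./2 *: (cm finset.setT *m A).
  apply: (can_inj (mulKmx u)); rewrite mulKVmx //.
  by rewrite -scalemxAr mulmxA sq mul_scalar_mx scalerA -expr2 sqrr_sign scale1r.
rewrite /cliff_coef e mxtraceZ mulrA; congr (_ * _).
rewrite eN natrX -!exprVn -!exprMn; congr (_ ^+ _).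
have i0 : ('i%C : R[i]) != 0 by rewrite eq_complex /= oner_eq0 andbF.
by rewrite invrN invfM mulrN mulr1 mulNr -mulrA mulVf // mulr1.
Qed.

End CliffordRep.

(** * Smooth functions and resolvent symbols *)

Local Open Scope classical_set_scope.

Section Smooth.
Variables (R : realType) (n : nat) (U : set 'rV[R]_n).
Hypothesis oU : open U.
Implicit Types (f g : 'rV[R]_n -> R) (x : 'rV[R]_n).

(** Grading smoothness by order makes the product and quotient rules usable by induction on k; the
    lists of derivatives in [smooth_on] allow no such direct induction. *)
Fixpoint Ck (k : nat) f : Prop :=
  (forall x, U x -> {for x, continuous f}) /\
  if k is k'.+1 then
    forall i, (forall x, U x -> derivable f x (delta_mx 0 i)) /\
              Ck k' (pderiv i f)
  else True.

Lemma smooth_on_Ck f : smooth_on U f -> forall k, Ck k f.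
Proof.
move=> sf k; elim: k f sf => [|k IH] f sf /=; split => //.
- by move=> x Ux; case: (sf [::] x Ux).
- by move=> x Ux; case: (sf [::] x Ux).
move=> i; split; first by move=> x Ux; case: (sf [::] x Ux).
by apply: IH => s x Ux; have := sf (rcons s i) x Ux; rewrite foldr_rcons.
Qed.

Lemma Ck_continuous k f x : Ck k f -> U x -> {for x, continuous f}.
Proof. by case: k => [|k] [cf _]; apply: cf. Qed.

Lemma Ck_leS k f : Ck k.+1 f -> Ck k f.
Proof.
elim: k f => [|k IH] f [cf df]; split => // i.
by have [? ?] := df i; split => //; apply: IH.
Qed.

Lemma near_eqU f g x : {in U, f =1 g} -> U x -> \forall y \near x, f y = g y.
Proof.
move=> fg Ux; have : nbhs x U by apply: open_nbhs_nbhs.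
by apply: filterS => y Uy; apply: fg; rewrite inE.
Qed.

Lemma pderiv_eqU f g i : {in U, f =1 g} -> {in U, pderiv i f =1 pderiv i g}.
Proof. by move=> fg x /set_mem Ux; apply: near_eq_derive; exact: (near_eqU fg Ux). Qed.

Lemma Ck_eq k f g : {in U, f =1 g} -> Ck k f -> Ck k g.
Proof.
have cE f' g' x : {in U, f' =1 g'} -> U x ->
    {for x, continuous f'} -> {for x, continuous g'}.
  move=> fg Ux cf; rewrite /prop_for /continuous_at -(fg x) ?inE //.
  by apply: (cvg_trans _ cf); apply: (near_eq_cvg (F := nbhs x)); exact: (near_eqU fg Ux).
elim: k f g => [|k IH] f g fg /= [cf df]; split => //.
- by move=> x Ux; apply: (cE f) => //; apply: cf.
- by move=> x Ux; apply: (cE f) => //; apply: cf.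
move=> i; have [d1 d2] := df i; split.
  by move=> x Ux; apply: near_eq_derivable (d1 x Ux); exact: (near_eqU fg Ux).
by apply: IH d2; apply: pderiv_eqU.
Qed.

Lemma Ck_cst k (c : R) : Ck k (fun=> c).
Proof.
elim: k c => [|k IH] c /=; split => //; try by move=> x _; exact: cst_continuous.
move=> i; split; first by move=> x _; apply: derivable_cst.
by apply: (Ck_eq _ (IH 0)) => x _; rewrite /pderiv derive_cst.
Qed.

Lemma CkD k f g : Ck k f -> Ck k g -> Ck k (fun x => f x + g x).
Proof.
elim: k f g => [|k IH] f g /= [cf df] [cg dg]; split => //;
  try by move=> x Ux; apply: continuousD; [apply: cf | apply: cg].
move=> i; have [d1 d2] := df i; have [e1 e2] := dg i; split.
  by move=> x Ux; apply: derivableD; [apply: d1 | apply: e1].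
apply: (Ck_eq _ (IH _ _ d2 e2)) => x /set_mem Ux.
by rewrite /pderiv -deriveD //; [apply: d1 | apply: e1].
Qed.

Lemma CkM k f g : Ck k f -> Ck k g -> Ck k (fun x => f x * g x).
Proof.
elim: k f g => [|k IH] f g hf hg.
  move: hf hg => [cf _] [cg _]; split => // x Ux.
  by apply: continuousM; [apply: cf | apply: cg].
have [cf df] := hf; have [cg dg] := hg; split.
  by move=> x Ux; apply: continuousM; [apply: cf | apply: cg].
move=> i; have [d1 d2] := df i; have [e1 e2] := dg i; split.
  by move=> x Ux; apply: derivableM; [apply: d1 | apply: e1].
apply: (Ck_eq _ (CkD (IH _ _ (Ck_leS hf) e2) (IH _ _ (Ck_leS hg) d2))).
by move=> x /set_mem Ux; rewrite /pderiv -[LHS]deriveM //; [apply: d1 | apply: e1].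
Qed.

(** The derivative -(1/f)^2 f' involves 1/f only undifferentiated, so order k for 1/f gives order k
    + 1. *)
Lemma CkV k f : (forall x, U x -> f x != 0) -> Ck k f -> Ck k (fun x => (f x)^-1).
Proof.
move=> f0; elim: k => [|k IH] hf.
  by have [cf _] := hf; split => // x Ux; apply: continuousV; [apply: f0 | apply: cf].
have [cf df] := hf; split.
  by move=> x Ux; apply: continuousV; [apply: f0 | apply: cf].
move=> i; have [d1 d2] := df i; have hV := IH (Ck_leS hf); split.
  by move=> x Ux; apply: derivableV; [apply: f0 | apply: d1].
apply: (Ck_eq _ (CkM (Ck_cst k (-1)) (CkM (CkM hV hV) d2))).
move=> x /set_mem Ux; rewrite /pderiv [RHS]deriveV; [|exact: f0|exact: d1].
by rewrite scaleNr mulN1r -expr2 exprVn.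
Qed.

Lemma Ck_coord k i : Ck k (fun x => x 0 i).
Proof.
have dc (x v : 'rV[R]_n) : derivable (fun x : 'rV[R]_n => x 0 i) x v.
  by have /derivable_mxP := @derivable_id _ _ x v; apply.
have cc (x : 'rV[R]_n) : {for x, continuous (fun x : 'rV[R]_n => x 0 i)}.
  exact: coord_continuous.
case: k => [|k]; split => // j; split => //.
apply: (Ck_eq _ (Ck_cst k ((delta_mx 0 j : 'rV[R]_n) 0 i))) => x _.
have := derive_mx (@derivable_id _ _ x (delta_mx 0 j : 'rV[R]_n)).
by rewrite derive_id => {1}->; rewrite mxE.
Qed.

End Smooth.

Section SmoothC.
Variables (R : realType) (n : nat) (U : set 'rV[R]_n).
Hypothesis oU : open U.
Notation C := R[i].
Implicit Types (f g : 'rV[R]_n -> C) (x : 'rV[R]_n).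

Definition smC f : Prop := forall k,
  Ck U k (fun x => complex.Re (f x)) /\ Ck U k (fun x => complex.Im (f x)).

Lemma smoothC_on_smC f : smoothC_on U f -> smC f.
Proof. by case=> sr si k; split; apply: smooth_on_Ck. Qed.

Lemma smC_eq f g : {in U, f =1 g} -> smC f -> smC g.
Proof.
move=> fg sf k; have [h1 h2] := sf k.
by split; [apply: (Ck_eq oU _ h1) | apply: (Ck_eq oU _ h2)] => x /fg ->.
Qed.

Lemma smC_cst (c : C) : smC (fun=> c).
Proof. by move=> k; split; apply: Ck_cst. Qed.

Lemma smCD f g : smC f -> smC g -> smC (fun x => f x + g x).
Proof.
move=> sf sg k; have [f1 f2] := sf k; have [g1 g2] := sg k; split.
  by apply: (Ck_eq oU _ (CkD oU f1 g1)) => x _; case: (f x) => ? ?; case: (g x).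
by apply: (Ck_eq oU _ (CkD oU f2 g2)) => x _; case: (f x) => ? ?; case: (g x).
Qed.

Lemma smCM f g : smC f -> smC g -> smC (fun x => f x * g x).
Proof.
move=> sf sg k; have [f1 f2] := sf k; have [g1 g2] := sg k; split.
  apply: (Ck_eq oU _ (CkD oU (CkM oU f1 g1)
    (CkM oU (Ck_cst oU k (-1)) (CkM oU f2 g2)))) => x _.
  by rewrite mulN1r; case: (f x) => ? ?; case: (g x).
apply: (Ck_eq oU _ (CkD oU (CkM oU f1 g2) (CkM oU f2 g1))) => x _.
by case: (f x) => ? ?; case: (g x).
Qed.

Lemma normc2_neq0 (z : C) : (z != 0) =
  (complex.Re z * complex.Re z + complex.Im z * complex.Im z != 0).
Proof.
case: z => a b; rewrite eq_complex /= -!expr2 paddr_eq0 ?sqr_ge0 //.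
by rewrite !sqrf_eq0.
Qed.

Lemma smCV f : (forall x, U x -> f x != 0) -> smC f -> smC (fun x => (f x)^-1).
Proof.
move=> f0 sf k; have [f1 f2] := sf k.
have hV := CkV oU (fun x Ux => etrans (esym (normc2_neq0 (f x))) (f0 x Ux))
  (CkD oU (CkM oU f1 f1) (CkM oU f2 f2)).
split.
  apply: (Ck_eq oU _ (CkM oU f1 hV)) => x _.
  by case: (f x) => a b /=; rewrite !expr2.
apply: (Ck_eq oU _ (CkM oU (Ck_cst oU k (-1)) (CkM oU f2 hV))) => x _.
by case: (f x) => a b /=; rewrite !expr2 mulN1r.
Qed.

Lemma smC_coord i : smC (fun x => (x 0 i)%:C%C).
Proof. by move=> k; split; [apply: Ck_coord | apply: Ck_cst]. Qed.

Lemma smC_sum (I : Type) (s : seq I) (P : pred I) (f : I -> 'rV[R]_n -> C) :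
  (forall i, smC (f i)) -> smC (fun x => \sum_(i <- s | P i) f i x).
Proof.
move=> sf; elim: s => [|i s IH].
  by apply: (smC_eq _ (smC_cst 0)) => x _; rewrite big_nil.
case Pi : (P i).
  by apply: (smC_eq _ (smCD (sf i) IH)) => x _; rewrite big_cons Pi.
by apply: (smC_eq _ IH) => x _; rewrite big_cons Pi.
Qed.

Lemma smC_prod (I : Type) (s : seq I) (f : I -> 'rV[R]_n -> C) :
  (forall i, smC (f i)) -> smC (fun x => \prod_(i <- s) f i x).
Proof.
move=> sf; elim: s => [|i s IH].
  by apply: (smC_eq _ (smC_cst 1)) => x _; rewrite big_nil.
by apply: (smC_eq _ (smCM (sf i) IH)) => x _; rewrite big_cons.
Qed.

Lemma smC_exp f k : smC f -> smC (fun x => f x ^+ k).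
Proof.
move=> sf; elim: k => [|k IH]; first by apply: (smC_eq _ (smC_cst 1)).
by apply: (smC_eq _ (smCM sf IH)) => x _; rewrite exprS.
Qed.

(* A linear combination commutes with a derivative only where the functions are
   differentiable, derivatives being junk values elsewhere. *)
Record local_linear (D : ('rV[R]_n -> C) -> 'rV[R]_n -> C) : Prop := LocalLinear {
  ll_eq : forall f g, {in U, f =1 g} -> {in U, D f =1 D g};
  ll_smC : forall f, smC f -> smC (D f);
  ll_add : forall f g, smC f -> smC g ->
    {in U, D (fun x => f x + g x) =1 fun x => D f x + D g x};
  ll_scale : forall (c : C) f, smC f ->
    {in U, D (fun x => c * f x) =1 fun x => c * D f x} }.

Lemma local_linear_id : local_linear id.
Proof. by split. Qed.

Lemma local_linear_comp D E : local_linear D -> local_linear E ->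
  local_linear (fun f => D (E f)).
Proof.
move=> lD lE; split.
- by move=> f g fg; apply: ll_eq => //; apply: ll_eq.
- by move=> f sf; apply: ll_smC => //; apply: ll_smC.
- move=> f g sf sg x xU; rewrite (ll_eq lD (ll_add lE sf sg)) //.
  by rewrite ll_add //; apply: ll_smC.
- move=> c f sf x xU; rewrite (ll_eq lD (ll_scale lE c sf)) //.
  by rewrite ll_scale //; apply: ll_smC.
Qed.

Lemma smC_derivable f x i : smC f -> U x ->
  derivable (fun y => complex.Re (f y)) x (delta_mx 0 i) /\
  derivable (fun y => complex.Im (f y)) x (delta_mx 0 i).
Proof.
move=> sf Ux; have [[_ hr] [_ hi]] := sf 1%N.
by split; [apply: (hr i).1 | apply: (hi i).1].
Qed.

Lemma local_linear_pderivC i : local_linear (pderivC i).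
Proof.
split.
- move=> f g fg x xU; rewrite /pderivC.
  by congr (_ +i* _)%C; apply: (pderiv_eqU oU i _ xU) => y yU; rewrite fg.
- by move=> f sf k; have [[_ hr] [_ hi]] := sf k.+1; split;
     [apply: (hr i).2 | apply: (hi i).2].
- move=> f g sf sg x /[dup] xU /set_mem Ux; rewrite /pderivC.
  have [f1 f2] := smC_derivable i sf Ux; have [g1 g2] := smC_derivable i sg Ux.
  transitivity (pderiv i (fun y => complex.Re (f y) + complex.Re (g y)) x
    +i* pderiv i (fun y => complex.Im (f y) + complex.Im (g y)) x)%C.
    by congr (_ +i* _)%C; apply: (pderiv_eqU oU i _ xU) => y _;
       case: (f y) => ? ?; case: (g y).
  by rewrite /pderiv (deriveD f1 g1) (deriveD f2 g2).
- move=> [a b] f sf x /[dup] xU /set_mem Ux; rewrite /pderivC.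
  have [f1 f2] := smC_derivable i sf Ux.
  transitivity (pderiv i (fun y => a * complex.Re (f y) + - b * complex.Im (f y)) x
    +i* pderiv i (fun y => a * complex.Im (f y) + b * complex.Re (f y)) x)%C.
    by congr (_ +i* _)%C; apply: (pderiv_eqU oU i _ xU) => y _;
       case: (f y) => ? ? /=; rewrite ?mulNr.
  rewrite /pderiv [X in (X +i* _)%C]deriveD; [|exact: derivableZ|exact: derivableZ].
  rewrite [X in (_ +i* X)%C]deriveD; [|exact: derivableZ|exact: derivableZ].
  have dZ (c : R) h : derivable h x (delta_mx 0 i) ->
      'D_(delta_mx 0 i) (fun y => c * h y) x = c * 'D_(delta_mx 0 i) h x.
    exact: deriveZ.
  by rewrite !dZ // mulNr.
Qed.

Lemma local_linear_Dmulti m (al : multi n m) : local_linear (Dmulti al).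
Proof.
rewrite /Dmulti; elim: (enum 'I_n) => [|i s IH] /=; first exact: local_linear_id.
elim: (nat_of_ord (al i)) => [|k IHk] //=.
exact: (local_linear_comp (local_linear_pderivC i) IHk).
Qed.

Lemma ll_sum D (I : Type) (s : seq I) (P : pred I) (c : I -> C) (f : I -> 'rV[R]_n -> C) :
  local_linear D -> (forall i, smC (f i)) ->
  {in U, D (fun x => \sum_(i <- s | P i) c i * f i x)
     =1 fun x => \sum_(i <- s | P i) c i * D (f i) x}.
Proof.
move=> lD sf; elim: s => [|i s IH] x xU.
  (* Writing 0 as [0 * 0] lets the scaling law give D 0 = 0. *)
  rewrite big_nil (ll_eq lD (g := fun=> 0 * 0)) //; last first.
    by move=> y _; rewrite big_nil mul0r.
  by rewrite (ll_scale lD) ?mul0r //; apply: smC_cst.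
rewrite big_cons; case Pi : (P i); last first.
  by rewrite -IH //; apply: ll_eq => // y _; rewrite big_cons Pi.
rewrite -IH // -(ll_scale lD) // -(ll_add lD) //.
- by apply: ll_eq => // y _; rewrite big_cons Pi.
- by apply: smCM => //; apply: smC_cst.
- by apply: smC_sum => j; apply: smCM => //; apply: smC_cst.
Qed.

End SmoothC.

Section SmoothMatrix.
Variables (R : realType) (n : nat) (U : set 'rV[R]_n).
Hypothesis oU : open U.
Notation C := R[i].

Definition smC_mx p q (F : 'rV[R]_n -> 'M[C]_(p, q)) : Prop :=
  forall i j, smC U (fun x => F x i j).

Lemma smC_mx_eq p q (F G : 'rV[R]_n -> 'M[C]_(p, q)) :
  {in U, F =1 G} -> smC_mx F -> smC_mx G.
Proof. by move=> FG sF i j; apply: (smC_eq oU _ (sF i j)) => x /FG ->. Qed.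

Lemma smC_mx_cst p q (A : 'M[C]_(p, q)) : smC_mx (fun=> A).
Proof. by move=> i j; apply: smC_cst. Qed.

Lemma smC_mxD p q (F G : 'rV[R]_n -> 'M[C]_(p, q)) :
  smC_mx F -> smC_mx G -> smC_mx (fun x => F x + G x).
Proof.
by move=> sF sG i j; apply: (smC_eq oU _ (smCD oU (sF i j) (sG i j))) => x _; rewrite mxE.
Qed.

Lemma smC_mxZ p q (c : 'rV[R]_n -> C) (F : 'rV[R]_n -> 'M[C]_(p, q)) :
  smC U c -> smC_mx F -> smC_mx (fun x => c x *: F x).
Proof.
by move=> sc sF i j; apply: (smC_eq oU _ (smCM oU sc (sF i j))) => x _; rewrite mxE.
Qed.

Lemma smC_mxN p q (F : 'rV[R]_n -> 'M[C]_(p, q)) :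
  smC_mx F -> smC_mx (fun x => - F x).
Proof.
move=> sF; apply: (smC_mx_eq _ (smC_mxZ (smC_cst oU (-1)) sF)) => x _.
by rewrite scaleN1r.
Qed.

Lemma smC_mulmx p q r (F : 'rV[R]_n -> 'M[C]_(p, q)) (G : 'rV[R]_n -> 'M[C]_(q, r)) :
  smC_mx F -> smC_mx G -> smC_mx (fun x => F x *m G x).
Proof.
move=> sF sG i j.
apply: (smC_eq oU _ (smC_sum oU (index_enum _) xpredT
  (fun k => smCM oU (sF i k) (sG k j)))) => x _.
by rewrite mxE.
Qed.

Lemma smC_mx_sum p q (I : Type) (s : seq I) (P : pred I)
    (F : I -> 'rV[R]_n -> 'M[C]_(p, q)) :
  (forall k, smC_mx (F k)) -> smC_mx (fun x => \sum_(k <- s | P k) F k x).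
Proof.
move=> sF i j; apply: (smC_eq oU _ (smC_sum oU s P (fun k => sF k i j))) => x _.
by rewrite summxE.
Qed.

Lemma smC_det p (F : 'rV[R]_n -> 'M[C]_p) : smC_mx F -> smC U (fun x => \det (F x)).
Proof.
move=> sF; apply: (smC_sum oU _ xpredT) => s; apply: (smCM oU); first exact: smC_cst.
by apply: (smC_prod oU) => i; apply: sF.
Qed.

(** By Cramer's formula, the adjugate over the determinant. *)
Lemma smC_invmx p (F : 'rV[R]_n -> 'M[C]_p) : (forall x, U x -> F x \in unitmx) ->
  smC_mx F -> smC_mx (fun x => invmx (F x)).
Proof.
move=> uF sF; have sA : smC_mx (fun x => \adj (F x)).
  move=> i j; apply: (smC_eq oU (f := fun x => cofactor (F x) j i)).
    by move=> x _; rewrite mxE.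
  apply: (smCM oU); first exact: smC_cst.
  by apply: smC_det => k l; apply: (smC_eq oU _ (sF (lift j k) (lift i l))) => x _;
     rewrite !mxE.
have sV : smC U (fun x => (\det (F x))^-1).
  apply: (smCV oU _ (smC_det sF)).
  by move=> x Ux; have := uF x Ux; rewrite unitmxE unitfE.
apply: (@smC_mx_eq _ _ (fun x => (\det (F x))^-1 *: \adj (F x))).
  move=> x /set_mem Ux; by rewrite /invmx (uF x Ux).
exact: smC_mxZ.
Qed.

Lemma smC_Dmulti_mx m (al : multi n m) p q (F : 'rV[R]_n -> 'M[C]_(p, q)) :
  smC_mx F -> smC_mx (Dmulti_mx al F).
Proof.
move=> sF i j; apply: (smC_eq oU _ (ll_smC (local_linear_Dmulti oU al) (sF i j))).
by move=> x _; rewrite mxE.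
Qed.

Lemma Dmulti_mx_eq m (al : multi n m) p q (F G : 'rV[R]_n -> 'M[C]_(p, q)) :
  {in U, F =1 G} -> {in U, Dmulti_mx al F =1 Dmulti_mx al G}.
Proof.
move=> FG x xU; apply/matrixP => i j; rewrite !mxE.
by apply: (ll_eq (local_linear_Dmulti oU al) _ xU) => y /FG ->.
Qed.

Section Linear.
Variables (p q p' q' : nat) (Phi : {linear 'M[C]_(p, q) -> 'M[C]_(p', q')}).

(** [linear_mxE] writes each entry of Phi (F y) as a combination, with constant coefficients, of the
    entries of F y, which reduces the claim to scalar functions. *)
Lemma Dmulti_mx_linear m (al : multi n m) F : smC_mx F ->
  {in U, Dmulti_mx al (fun y => Phi (F y)) =1 fun x => Phi (Dmulti_mx al F x)}.
Proof.
move=> sF x xU; apply/matrixP => k l; rewrite linear_mxE mxE.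
rewrite (ll_eq (local_linear_Dmulti oU al) (g := fun y => \sum_(u : 'I_p * 'I_q)
    Phi (delta_mx u.1 u.2) k l * F y u.1 u.2)) //; last first.
  by move=> y _; rewrite linear_mxE.
rewrite (ll_sum oU _ _ _ (local_linear_Dmulti oU al) (fun u => sF u.1 u.2)) //.
by apply: eq_bigr => u _; rewrite mxE.
Qed.

End Linear.
End SmoothMatrix.

(** * Homogeneous symbols and the resolvent recursion *)

Section Symbol.
Variables (R : realType) (n N m : nat) (Q : local_op R n N m).
Notation C := R[i].

Lemma smC_hsymb_xi a x : smC_mx setT (fun eta => hsymb Q a x eta).
Proof.
have oT := @openT 'rV[R]_n.
apply: (smC_mx_sum oT) => g; apply: (smC_mxZ oT); last exact: smC_mx_cst.
apply: (smC_prod oT) => i; apply: (smC_exp oT); apply: (smCM oT).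
  exact: smC_cst.
exact: smC_coord.
Qed.

Lemma nth_resolvents j b : (b < j)%N ->
  nth (fun _ _ _ => 0) (resolvents Q j) b = resolvent Q b.
Proof.
have sz k : size (resolvents Q k) = k.
  by elim: k => //= k IH; rewrite size_rcons IH.
elim: j => // j IH; rewrite ltnS leq_eqVlt => /orP[/eqP->//|bj].
by rewrite [resolvents Q j.+1]/= nth_rcons sz bj IH.
Qed.

Lemma resolventS j : resolvent Q j.+1 = resolvent_next Q j.+1 (resolvents Q j.+1).
Proof.
have sz k : size (resolvents Q k) = k.
  by elim: k => //= k IH; rewrite size_rcons IH.
by rewrite /resolvent [resolvents Q j.+2]/= nth_rcons -/(resolvents Q j.+1) sz ltnn eqxx.
Qed.

Variable W : set 'rV[R]_n.
Hypothesis oW : open W.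
Hypothesis sQ : forall g, smC_mx W (Q g).

Lemma smC_hsymb a xi : smC_mx W (fun y => hsymb Q a y xi).
Proof.
by apply: (smC_mx_sum oW) => g; apply: (smC_mxZ oW) => //; apply: smC_cst.
Qed.

(** The symbol is a finite sum of coefficients in y times monomials in the covector; the covector
    derivative touches only the monomials, so mixed derivatives never have to be exchanged. *)
Lemma smC_Dmulti_hsymb k (al : multi n k) a xi :
  smC_mx W (fun y => Dmulti_mx al (fun eta => hsymb Q a y eta) xi).
Proof.
move=> i j; have oT := @openT 'rV[R]_n.
pose mon (g : multi n m) (eta : 'rV[R]_n) : C :=
  \prod_i ('i%C * (eta 0 i)%:C%C : C) ^+ g i.
have smon g : smC setT (mon g).
  apply: (smC_prod oT) => u; apply: (smC_exp oT); apply: (smCM oT).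
    exact: smC_cst.
  exact: smC_coord.
apply: (smC_eq oW (f := fun y => \sum_(g : multi n m | (mlen g + a == m)%N)
   Q g y i j * Dmulti al (mon g) xi)).
  move=> y _; rewrite mxE -(ll_sum oT _ _ _ (local_linear_Dmulti oT al) smon) ?inE //.
  apply: (ll_eq (local_linear_Dmulti oT al)); rewrite ?inE // => eta _.
  by rewrite summxE; apply: eq_bigr => g _; rewrite mxE mulrC.
by apply: (smC_sum oW) => g; apply: (smCM oW); [exact: sQ | exact: smC_cst].
Qed.

Variables (xi : 'rV[R]_n) (mu : C).
Hypothesis uW : forall y, W y -> hsymb Q 0 y xi - mu%:M \in unitmx.

Lemma smC_resolvent0 : smC_mx W (fun y => resolvent0 Q y xi mu).
Proof.
apply: (smC_invmx oW) => //; apply: (smC_mxD oW); first exact: smC_hsymb.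
exact: smC_mx_cst.
Qed.

Lemma smC_resolvent j : smC_mx W (fun y => resolvent Q j y xi mu).
Proof.
elim/ltn_ind: j => -[_|j IH]; first exact: smC_resolvent0.
rewrite resolventS; apply: (smC_mxN oW); apply: (smC_mulmx oW smC_resolvent0).
apply: (smC_mx_sum oW) => b; apply: (smC_mx_sum oW) => al.
apply: (smC_mxZ oW); first exact: smC_cst.
apply: (smC_mulmx oW); first exact: smC_Dmulti_hsymb.
apply: (smC_Dmulti_mx oW); rewrite nth_resolvents //; exact: IH.
Qed.

End Symbol.

Section SymbolMorphism.
Variables (R : realType) (n N N' m : nat).
Notation C := R[i].
Variables (Phi : {linear 'M[C]_N -> 'M[C]_N'}).
Hypothesis PhiM : forall A B, Phi (A *m B) = Phi A *m Phi B.
Hypothesis Phi1 : Phi 1%:M = 1%:M.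
Hypothesis PhiV : forall A, Phi (invmx A) = invmx (Phi A).
Variables (Q : local_op R n N m) (Q' : local_op R n N' m).
Hypothesis Q'E : forall g x, Q' g x = Phi (Q g x).

Lemma hsymb_morph a x xi : hsymb Q' a x xi = Phi (hsymb Q a x xi).
Proof.
by rewrite /hsymb linear_sum; apply: eq_bigr => g _; rewrite linearZ Q'E.
Qed.

Lemma resolvent0_morph x xi mu : resolvent0 Q' x xi mu = Phi (resolvent0 Q x xi mu).
Proof.
have PhiMu : Phi mu%:M = mu%:M by rewrite -scalemx1 linearZ_LR Phi1 scalemx1.
by rewrite /resolvent0 PhiV hsymb_morph linearB PhiMu.
Qed.

Variable W : set 'rV[R]_n.
Hypothesis oW : open W.
Hypothesis sQ : forall g, smC_mx W (Q g).
Variables (xi : 'rV[R]_n) (mu : C).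
Hypothesis uW : forall y, W y -> hsymb Q 0 y xi - mu%:M \in unitmx.

(** Stated on a whole open set because the recursion differentiates the earlier terms in the base
    point. *)
Lemma resolvent_morph j :
  {in W, forall y, resolvent Q' j y xi mu = Phi (resolvent Q j y xi mu)}.
Proof.
elim/ltn_ind: j => -[_|j IH] x xW; first exact: resolvent0_morph.
rewrite !resolventS /resolvent_next linearN PhiM -resolvent0_morph.
congr (- (_ *m _)); rewrite linear_sum; apply: eq_bigr => b _.
rewrite linear_sum; apply: eq_bigr => al _; rewrite linearZ_LR PhiM.
congr (_ *: (_ *m _)).
  (* The covector derivative acts on a polynomial, smooth everywhere; the other factor is
     differentiated in the base point, within [W]. *)
  rewrite -(Dmulti_mx_linear (@openT _) Phi al (smC_hsymb_xi Q _ _)) ?inE //.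
  by apply: (Dmulti_mx_eq (@openT _)); rewrite ?inE // => eta _; rewrite hsymb_morph.
rewrite !nth_resolvents // -(Dmulti_mx_linear oW Phi al (smC_resolvent oW sQ uW b)) //.
by apply: (Dmulti_mx_eq oW) => // y yW; apply: IH.
Qed.

End SymbolMorphism.

Section OpenUnits.
Variables (R : realType) (n : nat) (U : set 'rV[R]_n).
Hypothesis oU : open U.
Notation C := R[i].

Lemma Ck_sub (W : set 'rV[R]_n) k f : W `<=` U -> Ck U k f -> Ck W k f.
Proof.
move=> WU; elim: k f => [|k IH] f [cf df]; split => //; try by move=> x /WU /cf.
by move=> i; have [d1 d2] := df i; split; [move=> x /WU /d1 | exact: IH].
Qed.

Lemma smC_mx_sub (W : set 'rV[R]_n) p q (F : 'rV[R]_n -> 'M[C]_(p, q)) :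
  W `<=` U -> smC_mx U F -> smC_mx W F.
Proof.
by move=> WU sF i j k; have [h1 h2] := sF i j k; split; apply: (Ck_sub WU).
Qed.

(** Invertibility amounts to positivity of |det|^2, a continuous real function on U. *)
Lemma open_unitmx p (F : 'rV[R]_n -> 'M[C]_p) : smC_mx U F ->
  open (U `&` [set y | F y \in unitmx]).
Proof.
move=> sF; rewrite openE => y [Uy uy].
have [h1 h2] := smC_det oU sF 0%N.
have h := CkD oU (CkM oU h1 h1) (CkM oU h2 h2).
have unitE z : F z \in unitmx <-> 0 < complex.Re (\det (F z)) * complex.Re (\det (F z))
    + complex.Im (\det (F z)) * complex.Im (\det (F z)).
  rewrite unitmxE unitfE normc2_neq0 lt0r -!expr2 addr_ge0 ?sqr_ge0 // andbT.
  by split.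
have hy := (unitE y).1 uy.
have near_pos := cvgr_gt _ (Ck_continuous h Uy) _ hy.
have near_U : nbhs y U by exact: open_nbhs_nbhs.
apply: filterS (filterI near_U (near_pos _)) => z [Uz z0].
by split => //; apply/unitE.
Qed.

End OpenUnits.

(** * Contour integrals and the logarithmic symbol *)

Section ComplexIntegral.
Variables (R : realType) (D : set R).
Hypothesis mD : (R.-ocitv.-measurable).-sigma.-measurable D.
Notation C := R[i].
Notation mu := (@lebesgue_measure R).

Let cintegrable (f : R -> C) : Prop :=
  mu.-integrable D (fun t => (complex.Re (f t))%:E) /\
  mu.-integrable D (fun t => (complex.Im (f t))%:E).

Let cint (f : R -> C) : C :=
  ((\int[mu]_(t in D) complex.Re (f t)) +i* (\int[mu]_(t in D) complex.Im (f t)))%C.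

Lemma integrable_lin2 (a b : R) (f g : R -> R) :
  mu.-integrable D (EFin \o f) -> mu.-integrable D (EFin \o g) ->
  mu.-integrable D (EFin \o (fun t => a * f t + b * g t)) /\
  \int[mu]_(t in D) (a * f t + b * g t) =
    a * (\int[mu]_(t in D) f t) + b * (\int[mu]_(t in D) g t).
Proof.
move=> hf hg.
have haf : mu.-integrable D (EFin \o (fun t => a * f t)).
  by apply: (eq_integrable mD _ _ _ (integrableZl mD a hf)) => t _ /=; rewrite EFinM.
have hbg : mu.-integrable D (EFin \o (fun t => b * g t)).
  by apply: (eq_integrable mD _ _ _ (integrableZl mD b hg)) => t _ /=; rewrite EFinM.
split; first by apply: (eq_integrable mD _ _ _ (integrableD mD haf hbg)) => t _.
by rewrite RintegralD // !RintegralZl.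
Qed.

Lemma cintegral_lin2 (c : C) (f g : R -> C) : cintegrable f -> cintegrable g ->
  cintegrable (fun t => c * f t + g t) /\
  cint (fun t => c * f t + g t) = c * cint f + cint g.
Proof.
case: c => a b [f1 f2] [g1 g2].
have [r1 e1] := integrable_lin2 a (- b) f1 f2.
have [i1 e2] := integrable_lin2 a b f2 f1.
have [r2 e3] := integrable_lin2 1 1 r1 g1.
have [i2 e4] := integrable_lin2 1 1 i1 g2.
have re t : complex.Re ((a +i* b)%C * f t + g t) =
    1 * (a * complex.Re (f t) + - b * complex.Im (f t)) + 1 * complex.Re (g t).
  by rewrite !mul1r mulNr; case: (f t) (g t) => ? ? [].
have im t : complex.Im ((a +i* b)%C * f t + g t) =
    1 * (a * complex.Im (f t) + b * complex.Re (f t)) + 1 * complex.Im (g t).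
  by rewrite !mul1r; case: (f t) (g t) => ? ? [].
split; first split.
- by apply: (eq_integrable mD _ _ _ r2) => t _ /=; rewrite re.
- by apply: (eq_integrable mD _ _ _ i2) => t _ /=; rewrite im.
rewrite /cint (eq_Rintegral mu (fun t _ => re t)) (eq_Rintegral mu (fun t _ => im t)).
by rewrite e3 e4 e1 e2 !mul1r mulNr.
Qed.

Lemma cintegral_sum (I : Type) (s : seq I) (c : I -> C) (f : I -> R -> C) :
  (forall k, cintegrable (f k)) ->
  cintegrable (fun t => \sum_(k <- s) c k * f k t) /\
  cint (fun t => \sum_(k <- s) c k * f k t) = \sum_(k <- s) c k * cint (f k).
Proof.
move=> hf; elim: s => [|k s [IH1 IH2]].
  have -> : (fun t => \sum_(k <- [::]) c k * f k t) = fun=> 0.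
    by apply/funext => t; rewrite big_nil.
  have z : mu.-integrable D (fun=> (0 : R)%:E) by exact: integrable0.
  rewrite big_nil; split; first by split.
  by rewrite /cint /Rintegral integral0.
have -> : (fun t => \sum_(j <- k :: s) c j * f j t) =
    fun t => c k * f k t + \sum_(j <- s) c j * f j t.
  by apply/funext => t; rewrite big_cons.
by have [h1 h2] := cintegral_lin2 (c k) (hf k) IH1; rewrite big_cons h2 IH2.
Qed.

Variables (N N' : nat) (Phi : {linear 'M[C]_N -> 'M[C]_N'}).

Lemma mx_integral_linear (f : R -> 'M[C]_N) : mx_integrable D f ->
  mx_integrable D (fun t => Phi (f t)) /\
  mx_int D (fun t => Phi (f t)) = Phi (mx_int D f).
Proof.
move=> hf.
have h k l := @cintegral_sum _ (index_enum ('I_N * 'I_N)%type)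
  (fun u => Phi (delta_mx u.1 u.2) k l) (fun u t => f t u.1 u.2)
  (fun u => hf u.1 u.2).
have e k l : (fun t => Phi (f t) k l) =
    fun t => \sum_(u : 'I_N * 'I_N) Phi (delta_mx u.1 u.2) k l * f t u.1 u.2.
  by apply/funext => t; rewrite linear_mxE.
split; first by move=> k l; have [+ _] := h k l; rewrite -e.
apply/matrixP => k l; rewrite mxE linear_mxE.
have [_] := h k l; rewrite -e /cint => ->.
by apply: eq_bigr => u _; rewrite mxE.
Qed.

Lemma eq_mx_integral (f g : R -> 'M[C]_N) : {in D, f =1 g} ->
  (mx_integrable D f -> mx_integrable D g) /\ mx_int D f = mx_int D g.
Proof.
move=> fg; split.
  move=> hf i j; have [h1 h2] := hf i j; split.
    by apply: (eq_integrable mD _ _ _ h1) => t tD; rewrite fg.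
  by apply: (eq_integrable mD _ _ _ h2) => t tD; rewrite fg.
apply/matrixP => i j; rewrite !mxE; congr (_ +i* _)%C;
  by apply: eq_Rintegral => t tD; rewrite fg.
Qed.

End ComplexIntegral.

Section Contour.
Variables (R : realType) (theta : R).
Notation C := R[i].

(** The points met by the contour for each small radius, in the form in which [is_contour_int]
    parametrises it. *)
Definition on_contour (P : C -> Prop) : Prop :=
  \forall rho \near (0 : R)^'+,
    (forall s, rho <= s -> P (polar s theta) /\ P (polar s (theta - pi *+ 2))) /\
    (forall phi, P (polar rho phi)).

Lemma on_contourS (P P' : C -> Prop) : (forall mu, P mu -> P' mu) ->
  on_contour P -> on_contour P'.
Proof.
move=> PP'; rewrite /on_contour; apply: filterS => rho [h1 h2].
split; last by move=> phi; apply: PP'.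
by move=> s /h1[? ?]; split; apply: PP'.
Qed.

Lemma contour_int_linear N N' (Phi : {linear 'M[C]_N -> 'M[C]_N'}) z f f' I :
  on_contour (fun mu => f' mu = Phi (f mu)) ->
  is_contour_int theta z f I -> is_contour_int theta z f' (Phi I).
Proof.
rewrite /is_contour_int /on_contour; apply: filterS2 => rho [hray hcirc] [i1 i2 i3 ->].
have key D (mD : (R.-ocitv.-measurable).-sigma.-measurable D) c p :
    (forall s, D s -> f' (p s) = Phi (f (p s))) ->
    mx_integrable D (fun s : R => c s *: f (p s)) ->
    mx_integrable D (fun s => c s *: f' (p s)) /\
    mx_int D (fun s => c s *: f' (p s)) = Phi (mx_int D (fun s => c s *: f (p s))).
  move=> e hf; have [h1 <-] := mx_integral_linear mD Phi hf.
  have eq : {in D, (fun s => Phi (c s *: f (p s))) =1 (fun s => c s *: f' (p s))}.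
    by move=> s /set_mem Ds; rewrite linearZ_LR e.
  by have [h2 h3] := eq_mx_integral mD eq; split; [apply: h2 | rewrite h3].
have hD s : `[rho, +oo[%classic s -> rho <= s by rewrite /= in_itv /= andbT.
have [j1 e1] := key _ (measurable_itv _) _ _ (fun s h => (hray s (hD s h)).1) i1.
have [j2 e2] := key _ (measurable_itv _) _ _ (fun s _ => hcirc s) i2.
have [j3 e3] := key _ (measurable_itv _) _ _ (fun s h => (hray s (hD s h)).2) i3.
have lin A B D : Phi (- A - B + D) = - Phi A - Phi B + Phi D.
  by rewrite linearD linearB linearN.
split; [exact: j1 | exact: j2 | exact: j3 | rewrite lin].
by congr (- _ - _ + _); [exact: esym e1 | exact: esym e2 | exact: esym e3].
Qed.

Lemma contour_int_unique N z (f : C -> 'M[C]_N) I J :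
  is_contour_int theta z f I -> is_contour_int theta z f J -> I = J.
Proof.
(* Both values are computed with one radius small enough for both. *)
by move=> hI hJ; have [rho [[_ _ _ ->] [_ _ _ ->]]] := filter_ex (filterI hI hJ).
Qed.

Lemma power_symb_linear n m N N' (Phi : {linear 'M[C]_N -> 'M[C]_N'})
    (Q : local_op R n N m) (Q' : local_op R n N' m) j x xi F :
  (forall (G : C^o -> 'M[C]_N) (z : C^o), derivable G z 1 -> derivable (Phi \o G) z 1) ->
  on_contour (fun mu => resolvent Q' j x xi mu = Phi (resolvent Q j x xi mu)) ->
  is_power_symb Q theta j x xi F -> is_power_symb Q' theta j x xi (Phi \o F).
Proof.
move=> dPhi hc [d1 d2 d3]; split.
- by move=> z /d1; apply: dPhi.
- by apply: filterS d2 => z; apply: dPhi.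
- move=> z /d3[I hI FI]; exists (Phi I); first exact: contour_int_linear hI.
  by rewrite /= FI linearZ_LR.
Qed.

End Contour.

Section LinearDerivative.
Variables (K : numFieldType) (N N' : nat) (Phi : {linear 'M[K]_N -> 'M[K]_N'}).

Lemma linear_mx_continuous : continuous (Phi : 'M[K]_N -> 'M[K]_N').
Proof.
have -> : (Phi : 'M[K]_N -> 'M[K]_N') = fun A =>
    \sum_(u : 'I_N * 'I_N) A u.1 u.2 *: Phi (delta_mx u.1 u.2).
  apply/funext => A; apply/matrixP => k l; rewrite linear_mxE summxE.
  by apply: eq_bigr => u _; rewrite mxE mulrC.
apply: continuous_big => [|u _ A]; first exact: add_continuous.
by apply: (cvgZ (F := nbhs A)); [exact: coord_continuous | exact: cvg_cst].
Qed.

Lemma derive_linear (F : K^o -> 'M[K]_N) (z : K^o) : derivable F z 1 ->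
  derivable (Phi \o F) z 1 /\ 'D_1 (Phi \o F) z = Phi ('D_1 F z).
Proof.
move=> dF.
have h : (fun h : K^o => h^-1 *: (((Phi \o F) \o shift z) (h *: 1) - (Phi \o F) z))
    @ (0 : K^o)^' --> Phi ('D_1 F z).
  have -> : (fun h : K^o => h^-1 *: (((Phi \o F) \o shift z) (h *: 1) - (Phi \o F) z)) =
     Phi \o (fun h : K^o => h^-1 *: ((F \o shift z) (h *: 1) - F z)).
    by apply/funext => h; rewrite [RHS]/= [RHS]linearZ_LR [X in _ = _ *: X]linearB.
  by apply: cvg_comp; [exact: dF | exact: linear_mx_continuous].
split; first by apply/cvg_ex; exists (Phi ('D_1 F z)).
exact: cvg_lim h.
Qed.

End LinearDerivative.

(** Power symbols are prescribed only for Re z < 0, and 0 lies on the boundary. Agreement along one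
    path to 0 suffices: the difference vanishes at 0 by continuity, hence so do its difference
    quotients along the path. *)
Lemma derive_eq_along (K : numFieldType) N (T : Type) (G : set_system T)
    (PG : ProperFilter G) (c : T -> K^o) (F1 F2 : K^o -> 'M[K]_N) :
  c @ G --> (0 : K^o)^' -> derivable F1 0 1 -> derivable F2 0 1 ->
  (\forall t \near G, F1 (c t) = F2 (c t)) -> 'D_1 F1 0 = 'D_1 F2 0.
Proof.
move=> hc d1 d2 F12; apply/eqP; rewrite -subr_eq0 -deriveB //; apply/eqP.
have dH : derivable (F1 - F2) 0 1 by exact: derivableB.
have H0 : \forall t \near G, (F1 - F2) (c t) = 0.
  by apply: filterS F12 => t e; rewrite -[LHS]/(F1 (c t) - F2 (c t)) e subrr.
move: (F1 - F2) dH H0 => H dH H0.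
have cH : H @ (0 : K^o) --> H 0.
  by apply: differentiable_continuous; apply/derivable1_diffP.
have HH : H 0 = 0.
  have h1 : (fun t => H (c t)) @ G --> H 0.
    apply: (cvg_comp _ _ hc).
    by apply: (cvg_trans _ cH); apply: cvg_app; exact: nbhs_dnbhs.
  have h2 : (fun t => H (c t)) @ G --> (0 : 'M[K]_N) by exact: cvg_near_cst.
  exact: (cvg_unique (@norm_hausdorff _ _) h1 h2).
have h1 : (fun t => (c t)^-1 *: ((H \o shift (0 : K^o)) (c t *: 1) - H 0))
    @ G --> 'D_1 H 0.
  exact: (cvg_comp c
    (fun h : K^o => h^-1 *: ((H \o shift (0 : K^o)) (h *: 1) - H 0)) hc dH).
have h2 : (fun t => (c t)^-1 *: ((H \o shift (0 : K^o)) (c t *: 1) - H 0))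
    @ G --> (0 : 'M[K]_N).
  apply: cvg_near_cst; apply: filterS H0 => t Ht.
  by rewrite /= addr0 HH subr0 [_ *: 1]mulr1 Ht scaler0.
exact: (cvg_unique (@norm_hausdorff _ _) h1 h2).
Qed.

Lemma cvg_negreal (R : realType) :
  (fun t : R => ((- t)%:C%C : R[i]^o)) @ (0 : R)^'+ --> (0 : R[i]^o)^'.
Proof.
(* The radius [e] is a complex number; the order on R[i] makes a positive one real. *)
move=> A [e /= e0 eA]; have [er0 ee] : 0 < complex.Re e /\ e = (complex.Re e)%:C%C.
  by move: e0; rewrite ltcE /=; case: (e) => a b /= /andP[/eqP -> ?].
suff : \forall t \near (0 : R)^'+, A ((- t)%:C%C) by [].
near=> t; apply: eA.
  rewrite /= (_ : 0 - (- t)%:C%C = t%:C%C); last by rewrite rmorphN sub0r opprK.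
  rewrite normc_def /= expr0n addr0 sqrtr_sqr ee ltcR.
  by rewrite gtr0_norm; [near: t; exact: nbhs_right_lt | near: t; exact: nbhs_right_gt].
rewrite eq_complex /= oppr_eq0 negb_and; apply/orP; left.
by rewrite gt_eqF //; near: t; exact: nbhs_right_gt.
Unshelve. all: by end_near. Qed.

Section LogSymbol.
Variables (R : realType) (n m N N' : nat).
Notation C := R[i].
Variables (Phi : {linear 'M[C]_N -> 'M[C]_N'}) (Psi : {linear 'M[C]_N' -> 'M[C]_N}).
Hypothesis PhiK : cancel Phi Psi.

Lemma power_symb_deriv_unique k (Q : local_op R n k m) theta j x xi F G :
  is_power_symb Q theta j x xi F -> is_power_symb Q theta j x xi G ->
  'D_1 F (0 : C^o) = 'D_1 G (0 : C^o).
Proof.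
move=> [_ dF eF] [_ dG eG]; apply: (derive_eq_along _ (@cvg_negreal R)).
- exact: (nbhs_singleton dF).
- exact: (nbhs_singleton dG).
near=> t; have z0 : complex.Re ((- t)%:C%C : C) < 0.
  by rewrite /= oppr_lt0; near: t; exact: nbhs_right_gt.
have [I hI ->] := eF _ z0; have [J hJ ->] := eG _ z0.
by rewrite (contour_int_unique hI hJ).
Unshelve. all: by end_near. Qed.

(** If Q has a power symbol, its image under Phi is one for Q' and the derivatives at 0 correspond.
    Otherwise Q' has none either, since Psi would carry it back, and both sides are the default
    0. *)
Lemma log_symb_linear (Q : local_op R n N m) (Q' : local_op R n N' m) theta j x xi :
  on_contour theta (fun mu => resolvent Q' j x ((enorm xi)^-1 *: xi) mu =
    Phi (resolvent Q j x ((enorm xi)^-1 *: xi) mu)) ->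
  log_symb Q' theta j x xi = Phi (log_symb Q theta j x xi).
Proof.
move=> hc; rewrite /log_symb linearZ_LR; congr (_ *: _).
set y := (enorm xi)^-1 *: xi in hc *.
have hc' : on_contour theta (fun mu =>
    resolvent Q j x y mu = Psi (resolvent Q' j x y mu)).
  by apply: on_contourS hc => mu ->; rewrite PhiK.
have dPhi := fun G z dG => (@derive_linear _ N N' Phi G z dG).1.
have dPsi := fun G z dG => (@derive_linear _ N' N Psi G z dG).1.
case: (pselect (exists F, is_power_symb Q theta j x y F)) => [[F hF]|hN].
  have hF' := power_symb_linear dPhi hc hF.
  have dF : derivable F (0 : C^o) 1 by have [_ /nbhs_singleton] := hF.
  rewrite (xget_unique _ (x := 'D_1 F (0 : C^o))); first last.
  - by move=> L [G hG ->]; exact: power_symb_deriv_unique hG hF.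
  - by exists F.
  rewrite (xget_unique _ (x := 'D_1 (Phi \o F) (0 : C^o))); first last.
  - by move=> L [G hG ->]; exact: power_symb_deriv_unique hG hF'.
  - by exists (Phi \o F).
  exact: (derive_linear Phi dF).2.
rewrite [in RHS]xgetPN; last by move=> L [F hF _]; apply: hN; exists F.
rewrite linear0 xgetPN // => L [F hF _]; apply: hN; exists (Psi \o F).
exact: power_symb_linear dPsi hc' hF.
Qed.

End LogSymbol.

(** * Integration over the sphere *)

Section HomogeneousIntegral.
Context d (T : measurableType d) (R : realType) (mu : {measure set T -> \bar R}).

Import HBNNSimple.

(** The integral is a supremum over simple functions below f, and these rescale by k^-1. This gives
    one inequality; the other is the same one for k^-1 and k f. *)
Lemma ge0_integralZl_gt0 (f : T -> \bar R) (k : R) : (forall x, 0 <= f x)%E -> 0 < k ->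
  (\int[mu]_x (k%:E * f x) = k%:E * \int[mu]_x f x)%E.
Proof.
have le (g : T -> \bar R) (c : R) : (forall x, 0 <= g x)%E -> 0 < c ->
    (\int[mu]_x (c%:E * g x) <= c%:E * \int[mu]_x g x)%E.
  move=> g0 c0; rewrite ge0_integralTE; last first.
    by move=> x; rewrite mule_ge0 // lee_fin ltW.
  apply: ge_ereal_sup => _ [u /= ug <-].
  have c0' : 0 <= c^-1 by rewrite invr_ge0 ltW.
  have e : (sintegral mu u = c%:E * sintegral mu (scale_nnsfun u c0'))%E.
    rewrite (_ : (scale_nnsfun u c0' : T -> R) = (cst c^-1 \* u)) // sintegralrM.
    by rewrite muleA -EFinM divff ?mul1e // gt_eqF.
  rewrite e lee_pmul2l ?fin_num_gt0 // ?lte_fin //.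
  rewrite ge0_integralTE //; apply: ereal_sup_ubound.
  exists (scale_nnsfun u c0') => // x /=.
  by rewrite EFinM lee_pdivrMl.
move=> f0 k0; apply/eqP; rewrite eq_le le //=.
have ki0 : 0 < k^-1 by rewrite invr_gt0.
have kf0 x : (0 <= k%:E * f x)%E by rewrite mule_ge0 // lee_fin ltW.
have := le _ _ kf0 ki0; rewrite lee_pdivlMl //.
by under eq_integral do rewrite muleA -EFinM mulVf ?gt_eqF // mul1e.
Qed.

(* No integrability hypothesis: [fine] sends the infinite values to 0 and
   -(oo - oo) to 0. *)
Lemma RintegralZl_uncond (D : set T) (f : T -> R) (r : R) :
  \int[mu]_(x in D) (r * f x) = r * \int[mu]_(x in D) f x.
Proof.
rewrite Rintegral_mkcond [in RHS]Rintegral_mkcond.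
have -> : (fun x => r * f x) \_ D = (fun x => r * (f \_ D) x).
  by apply/funext => x; rewrite /patch; case: ifP; rewrite ?mulr0.
move: (f \_ D) => {D}{}f; rewrite /Rintegral.
have fineB (a b : \bar R) : fine (a - b)%E = - fine (b - a)%E.
  by case: a b => [a| |] [b| |] //=; rewrite ?opprB ?oppr0.
have fineZ (c : R) (a b : \bar R) : 0 < c ->
    fine (c%:E * a - c%:E * b)%E = c * fine (a - b)%E.
  move=> c0; case: a b => [a| |] [b| |] /=;
    rewrite ?(gt0_muley, gt0_muleNy) ?lte_fin //= ?mulr0 // mulrBr //.
have p0 (g : T -> \bar R) x : (0 <= g^\+ x)%E by exact: funepos_ge0.
have n0 (g : T -> \bar R) x : (0 <= g^\- x)%E by exact: funeneg_ge0.
have e : (fun x => (r * f x)%:E) = (fun x => r%:E * (f x)%:E)%E by [].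
have [r0|r0|->] := ltgtP r 0.
(* A negative factor exchanges the positive and negative parts. *)
- rewrite e integralE le0_funeposM ?ltW // le0_funenegM ?ltW //.
  rewrite -EFinN !ge0_integralZl_gt0 ?oppr_gt0 // fineZ ?oppr_gt0 //.
  by rewrite fineB mulrNN [in RHS]integralE.
- rewrite e integralE ge0_funeposM ?ltW // ge0_funenegM ?ltW //.
  by rewrite !ge0_integralZl_gt0 // fineZ // [in RHS]integralE.
- rewrite mul0r; under eq_integral do rewrite mul0r.
  by rewrite integral0.
Qed.

End HomogeneousIntegral.

Section SphereIntegral.
Variable R : realType.
Notation C := R[i].

Lemma sphere_intZ n (f : 'rV[R]_n -> R) (r : R) :
  sphere_int (fun xi => r * f xi) = r * sphere_int f.
Proof.
case: n f => [f|n]; rewrite /sphere_int ?mulr0 //.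
elim: n => [|n IH] f /=; first by rewrite mulrDr.
rewrite -RintegralZl_uncond; apply: eq_Rintegral => t _.
by rewrite IH mulrCA.
Qed.

Lemma enorm_row_sphere n (t : R) (w : 'rV[R]_n.+1) : enorm w = 1 ->
  enorm (row_mx (cos t)%:M (sin t *: w) : 'rV[R]_(1 + n.+1)) = 1.
Proof.
rewrite /enorm => w1; have s1 : \sum_i w 0 i ^+ 2 = 1.
  have : 0 <= \sum_i w 0 i ^+ 2 by apply: sumr_ge0 => i _; exact: sqr_ge0.
  by move/sqr_sqrtr <-; rewrite w1 expr1n.
rewrite big_split_ord /= big_ord1 row_mxEl mxE eqxx mulr1n.
rewrite (eq_bigr (fun i => sin t ^+ 2 * w 0 i ^+ 2)); last first.
  by move=> i _; rewrite row_mxEr mxE exprMn.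
by rewrite -mulr_sumr s1 mulr1 cos2Dsin2 sqrtr1.
Qed.

(** The iterated polar integral evaluates its integrand only at unit vectors. *)
Lemma eq_sphere_int n (f g : 'rV[R]_n -> R) :
  (forall xi, enorm xi = 1 -> f xi = g xi) -> sphere_int f = sphere_int g.
Proof.
case: n f g => [//|n]; rewrite /sphere_int; elim: n => [|n IH] f g fg /=.
  by rewrite !fg // /enorm big_ord1 mxE ?sqrrN expr1n sqrtr1.
apply: eq_Rintegral => t _; congr (_ * _); apply: IH => w w1.
by apply: fg; exact: enorm_row_sphere.
Qed.

Lemma eq_sphere_intC n (f g : 'rV[R]_n -> C) :
  (forall xi, enorm xi = 1 -> f xi = g xi) -> sphere_intC f = sphere_intC g.
Proof.
by move=> fg; congr (_ +i* _)%C; apply: eq_sphere_int => xi /fg ->.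
Qed.

Lemma sphere_intCZ_real n (f : 'rV[R]_n -> C) (r : R) :
  sphere_intC (fun xi => r%:C%C * f xi) = r%:C%C * sphere_intC f.
Proof.
have -> : r%:C%C * sphere_intC f = (r * sphere_int (fun xi => complex.Re (f xi))
    +i* (r * sphere_int (fun xi => complex.Im (f xi))))%C.
  by rewrite /sphere_intC; apply/eqP; rewrite eq_complex /= !mul0r subr0 addr0 !eqxx.
rewrite -!sphere_intZ; congr (_ +i* _)%C; apply: eq_sphere_int => xi _.
  by case: (f xi) => a b /=; rewrite mul0r subr0.
by case: (f xi) => a b /=; rewrite mul0r addr0.
Qed.

(* For a general complex scalar this would need integrability on the sphere;
   powers of (-2i)^-1 only use this case. *)
Lemma sphere_intCZ_imag n (f : 'rV[R]_n -> C) (r : R) :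
  sphere_intC (fun xi => (0 +i* r)%C * f xi) = (0 +i* r)%C * sphere_intC f.
Proof.
have -> : (0 +i* r)%C * sphere_intC f = (- r * sphere_int (fun xi => complex.Im (f xi))
    +i* (r * sphere_int (fun xi => complex.Re (f xi))))%C.
  by rewrite /sphere_intC; apply/eqP; rewrite eq_complex /= !mul0r sub0r add0r mulNr !eqxx.
rewrite -!sphere_intZ; congr (_ +i* _)%C; apply: eq_sphere_int => xi _.
  by case: (f xi) => a b /=; rewrite mul0r sub0r mulNr.
by case: (f xi) => a b /=; rewrite mul0r add0r.
Qed.

Lemma sphere_intCZ_imagX n (f : 'rV[R]_n -> C) (r : R) k :
  sphere_intC (fun xi => (0 +i* r)%C ^+ k * f xi) = (0 +i* r)%C ^+ k * sphere_intC f.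
Proof.
elim: k f => [|k IH] f.
  by rewrite expr0 mul1r; apply: eq_sphere_intC => xi _; rewrite mul1r.
rewrite exprS -mulrA -IH -sphere_intCZ_imag.
by apply: eq_sphere_intC => xi _; rewrite mulrA.
Qed.

End SphereIntegral.

(** * Spinors and forms *)

Section Spectrum.
Variable R : realType.
Notation C := R[i].

Lemma polarE (s phi : R) : polar s phi = (s * cos phi +i* (s * sin phi))%C.
Proof.
rewrite /polar /cexp /= expR0 mul1r; apply/eqP; rewrite eq_complex /=.
by rewrite !mul0r subr0 addr0 !eqxx.
Qed.

(** The two rays of the contour consist of the same points and differ only in the branch of mu^z, so
    the spectral condition on L_theta serves both. *)
Lemma polarB2pi (s phi : R) : polar s (phi - pi *+ 2) = polar s phi.
Proof. by rewrite !polarE -(cosD2pi (phi - _)) -(sinD2pi (phi - _)) subrK. Qed.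

Lemma unitmx_sub_scalar (F : fieldType) N (A : 'M[F]_N) a :
  ~~ eigenvalue A a -> A - a%:M \in unitmx.
Proof. by rewrite negbK kermx_eq0 row_free_unit. Qed.

(** The spectrum is finite, and each eigenvalue is avoided by all sufficiently small positive
    radii. *)
Lemma near_circle_unit N (A : 'M[C]_N) :
  \forall rho \near (0 : R)^'+, forall phi, A - (polar rho phi)%:M \in unitmx.
Proof.
have [rs ers] := closed_field_poly_normal (char_poly A).
suff : \forall rho \near (0 : R)^'+, forall phi, polar rho phi \notin rs.
  apply: filterS => rho h phi; apply: unitmx_sub_scalar.
  rewrite eigenvalue_root_char ers rootZ ?lead_coef_eq0 ?char_poly_neq0 //.
    by rewrite root_prod_XsubC.
  by rewrite monic_neq0 // char_poly_monic.
elim: rs {ers} => [|z rs IH]; first by apply: nearW.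
pose q := Num.sqrt (complex.Re z ^+ 2 + complex.Im z ^+ 2).
have hz : \forall rho \near (0 : R)^'+, 0 < rho /\ rho != q.
  have [q0|q0] := eqVneq q 0.
    apply: filterS (nbhs_right_gt 0) => rho r0; split => //.
    by rewrite q0 gt_eqF.
  have qp : 0 < q by rewrite lt0r q0 sqrtr_ge0.
  apply: filterS2 (nbhs_right_gt 0) (nbhs_right_lt qp) => rho r0 rq; split => //.
  by rewrite lt_eqF.
apply: filterS2 IH hz => rho h [r0 rq] phi; rewrite inE negb_or h andbT.
apply: contra rq => /eqP ez; rewrite /q -ez polarE /= !exprMn -mulrDr cos2Dsin2 mulr1.
by rewrite sqrtr_sqr gtr0_norm.
Qed.

End Spectrum.

Section SpinSymbol.
Variables (R : realType) (n : nat) (n_even : ~~ odd n).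
Variables (M : closed_manifold R n) (g : riemannian_metric M) (S : spin_structure g).
Variables (m : nat) (P : diff_op S m) (theta : R) (P_agmon : agmon_angle P theta).
Variables (a : cm_idx M) (x : 'rV[R]_n) (xU : cm_img M a x).
Notation C := R[i].
Notation Phi := (cliff_rep (ss_gam S)).

Lemma dim_spinor_sq : dimLambda n = (2 ^ n./2 * 2 ^ n./2)%N.
Proof.
rewrite /dimLambda -cardsT -powersetT card_powerset cardsT card_ord -expnD addnn.
by rewrite -[in LHS](odd_double_half n) (negPf n_even).
Qed.

Lemma cg_opE gamma y : cg_op P a gamma y = Phi (do_local P a gamma y).
Proof.
rewrite /cg_op /do_local /clifford_op linear_sum; apply: eq_bigr => I _.
rewrite linearZ_LR; congr (_ *: _); apply: esym.
apply: (cliff_rep_mono (ss_clifford S) n_even _ dim_spinor_sq).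
by rewrite expn_gt0.
Qed.

Lemma smC_do_local gamma : smC_mx (cm_img M a) (do_local P a gamma).
Proof.
have oU := @cm_img_open R n M a; apply: (smC_mx_sum oU) => I; apply: (smC_mxZ oU).
  exact/smoothC_on_smC/do_smooth.
exact: smC_mx_cst.
Qed.

(** Invertibility at x persists on an open neighbourhood, which supplies the set [W] of
    [resolvent_morph]. *)
Lemma resolvent_cg_op j xi mu : hsymb (do_local P a) 0 x xi - mu%:M \in unitmx ->
  resolvent (cg_op P a) j x xi mu = Phi (resolvent (do_local P a) j x xi mu).
Proof.
move=> ux; have oU := @cm_img_open R n M a.
have sH : smC_mx (cm_img M a) (fun y => hsymb (do_local P a) 0 y xi - mu%:M).
  apply: (smC_mxD oU); first exact: (smC_hsymb oU smC_do_local).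
  exact: smC_mx_cst.
have oW := open_unitmx oU sH.
have gamP := ss_clifford S; have N0 : (0 < 2 ^ n./2)%N by rewrite expn_gt0.
have dimN := dim_spinor_sq.
set W := _ `&` _ in oW; have xW : x \in W by rewrite inE.
have sW gamma : smC_mx W (do_local P a gamma).
  by apply: smC_mx_sub (smC_do_local gamma) => y [].
have uW y : W y -> hsymb (do_local P a) 0 y xi - mu%:M \in unitmx by case.
exact: (resolvent_morph (cliff_repM gamP n_even N0 dimN)
  (cliff_rep1 gamP n_even N0) (cliff_rep_inv gamP n_even N0 dimN)
  cg_opE oW sW uW j xW).
Qed.

Lemma log_symb_cg_op j xi : enorm xi = 1 ->
  log_symb (cg_op P a) theta j x xi = Phi (log_symb (do_local P a) theta j x xi).
Proof.
move=> xi1; have gamP := ss_clifford S.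
have N0 : (0 < 2 ^ n./2)%N by rewrite expn_gt0.
apply: (log_symb_linear (cliff_repK gamP n_even N0 dim_spinor_sq)).
rewrite xi1 invr1 scale1r.
have xi0 : xi != 0.
  apply/negP => /eqP xi0; move: xi1; rewrite xi0 /enorm big1 ?sqrtr0.
    by move/eqP; rewrite eq_sym oner_eq0.
  by move=> i _; rewrite mxE expr0n.
apply: (on_contourS (P := fun mu => hsymb (do_local P a) 0 x xi - mu%:M \in unitmx)).
  by move=> mu; apply: resolvent_cg_op.
rewrite /on_contour.
apply: filterS2 (near_circle_unit (hsymb (do_local P a) 0 x xi)) (nbhs_right_gt 0).
move=> rho hcirc rho0; split => // s rs; rewrite polarB2pi.
suff h : hsymb (do_local P a) 0 x xi - (polar s theta)%:M \in unitmx by [].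
by apply: unitmx_sub_scalar; apply: P_agmon.1 => //; apply: le_trans rs; apply: ltW.
Qed.

(** Orthonormality E g E^T = 1 gives det g = (det E)^-2, and the orientation of the frame selects
    the positive root. *)
Lemma det_coframe : \det (coframe S a x) = vol_density g a x.
Proof.
have o := ss_frame_orth S xU; have d0 := ss_frame_oriented S xU.
rewrite /coframe det_tr det_inv /vol_density.
have := congr1 determinant o; rewrite !det_mulmx det_tr det1 => e.
have -> : \det (g a x) = (\det (ss_frame S a x))^-1 ^+ 2.
  apply: (mulfI (lt0r_neq0 d0)); apply: (mulIf (lt0r_neq0 d0)); rewrite e.
  by rewrite expr2 mulrA mulfV ?mul1r ?mulVf ?lt0r_neq0.
by rewrite sqrtr_sqr gtr0_norm // invr_gt0.
Qed.

End SpinSymbol.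

Theorem proposition3p8 (R : realType) (n : nat) (n_even : ~~ odd n)
    (M : closed_manifold R n) (g : riemannian_metric M) (S : spin_structure g)
    (m : nat) (m_gt0 : (0 < m)%N) (P : diff_op S m) (theta : R)
    (P_agmon : agmon_angle P theta) (P_even : even_op P)
    (a : cm_idx M) (p : M) (r : R) (Up : normal_neighborhood S a p r)
    (x : 'rV[R]_n) (x_Up : eball r x) :
  omega_res_form S (cg_op P a) theta a x =
  (vol_density g a x)%:C%C * ((- (2%:R * 'i%C) : R[i]) ^- n./2)
    * omega_sres P theta a x.
Proof.
have xU : cm_img M a x by have [_ _ _ -> _] := Up.
have gamP := ss_clifford S; have N0 : (0 < 2 ^ n./2)%N by rewrite expn_gt0.
have dimN := dim_spinor_sq n_even.
have c_imag : (- (2%:R * 'i%C) : R[i])^-1 = (0 +i* 2^-1)%C.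
  have i0 : (- (2%:R * 'i%C) : R[i]) != 0.
    by rewrite oppr_eq0 mulf_neq0 ?pnatr_eq0 // eq_complex /= oner_eq0 andbF.
  apply: (mulfI i0); rewrite mulfV //; apply/eqP; rewrite eq_complex /=.
  by apply/andP; split; apply/eqP; field.
rewrite /omega_res_form /omega_sres mulrCA; congr (_ * _).
(* Both constants go inside the integral, and the integrands are then compared at unit covectors. *)
rewrite -exprVn c_imag -mulrA -sphere_intCZ_imagX -sphere_intCZ_real.
apply: eq_sphere_intC => xi xi1; rewrite log_symb_cg_op // top_coef_cliff_rep.
rewrite (cliff_coef_setT gamP) // det_coframe // -exprVn c_imag.
by rewrite mulrC.
Qed.
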